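(* Every connected component of a dual equivalence graph of type $(n,n)$ is isomorphic to the standard dual equivalence graph $\mathcal{G}_\lambda$ for a unique partition $\lambda$ of $n$.
   Context: Tableaux conventions. Partitions $\lambda=(\lambda_1\ge\dots\ge\lambda_l>0)$; French diagram: cells $(i,j)$ with $1\le i\le\lambda_j$, row $1$ at the bottom. $\mathrm{SYT}(\lambda)$: bijections from the cells to $[n]$ increasing along rows (left to right) and columns (bottom to top). Content of $(i,j)$ is $i-j$. Content reading word: entries in increasing order of content, each diagonal read southwest to northeast. Descent signature $\sigma(T)\in\{\pm1\}^{n-1}$: $\sigma(T)_i=+1$ iff $i$ appears left of $i+1$ in the reading word. For $1<i<n$, $d_i$ on words: identity if $i$ lies positionally between $i-1$ and $i+1$; otherwise swap $i$ with whichever of $i\pm1$ is farther from $i$. On tableaux, $d_i$ swaps the corresponding entries (result is standard). A signed, colored graph of type $(n,N)$ is $(V,\sigma,E)$: finite $V$, $\sigma:V\to\{\pm1\}^{N-1}$, and for $1<i<n$ a set $E_i$ of $2$-element subsets of $V$. It is a dual equivalence graph of type $(n,N)$ if $n\le N$ and (indices only where defined): (ax1) for $w\in V$, $1<i<n$: $\sigma(w)_{i-1}=-\sigma(w)_i$ iff some $x$ has $\{w,x\}\in E_i$, and such $x$ is unique; (ax2) if $\{w,x\}\in E_i$: $\sigma(w)_j=-\sigma(x)_j$ for $j=i-1,i$, and $\sigma(w)_h=\sigma(x)_h$ for $h<i-2$ and $h>i+1$; (ax3) if $\{w,x\}\in E_i$ and $\sigma(w)_{i-2}=-\sigma(x)_{i-2}$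 then $\sigma(w)_{i-2}=-\sigma(w)_{i-1}$; if $\sigma(w)_{i+1}=-\sigma(x)_{i+1}$ then $\sigma(w)_{i+1}=-\sigma(w)_i$; (ax4) each connected component of $(V,E_{i-1}\cup E_i)$ is: a single vertex; or a path $x,y,z$ with $\{x,y\}\in E_{i-1}$, $\{y,z\}\in E_i$ and no other edges; or two vertices joined by both an $E_{i-1}$- and an $E_i$-edge. Each connected component of $(V,E_{i-2}\cup E_{i-1}\cup E_i)$ is: (a) a single vertex; (b) a path $p,q,r,s$ with only edges $\{p,q\}\in E_{i-2}$, $\{q,r\}\in E_{i-1}$, $\{r,s\}\in E_i$; (c) five vertices $a,b,c,d,e$ with only edges $\{a,b\}\in E_{i-2}\cap E_{i-1}$, $\{b,c\}\in E_i$, $\{c,d\}\in E_{i-2}$, $\{d,e\}\in E_{i-1}\cap E_i$; (d) six vertices $u,v,w,x,y,z$ with only edges $\{u,v\}\in E_{i-1}$, $\{v,w\}\in E_{i-2}$, $\{v,x\}\in E_i$, $\{w,y\}\in E_i$, $\{x,y\}\in E_{i-2}$, $\{y,z\}\in E_{i-1}$; (ax5) if $\{w,x\}\in E_i$, $\{x,y\}\in E_j$, $|i-j|\ge3$, then some $v$ has $\{w,v\}\in E_j$, $\{v,y\}\in E_i$; (ax6) for each $1<i<n$, any two vertices of a connected component of $(V,E_2\cup\dots\cup E_i)$ are joined by a path in it using at most one $E_i$-edge. $\mathcal{G}_\lambda$ ($|\lambda|=n$) is the graph of type $(n,n)$ on $\mathrm{SYT}(\lambda)$ with the descent signature and $E_i=\{\{T,d_i(T)\}:d_i(T)\ne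 T\}$. An isomorphism of signed colored graphs of type $(n,N)$ is a bijection $\phi$ on vertices with $\sigma(\phi(v))=\sigma(v)$ and mapping $i$-edges to $i$-edges for every $i$. *)

(* Defs.v *)
From mathcomp Require Import all_boot.
Set Implicit Arguments. Unset Strict Implicit. Unset Printing Implicit Defensive.

Definition is_partition (n : nat) (lam : seq nat) : bool :=
  [&& sorted geq lam, all (fun x => 0 < x) lam & sumn lam == n].

(* A tableau is a seq of rows; row j (1-based) of the paper is
   nth [::] T (j-1), the bottom row being nth [::] T 0.  The cell
   (i,j) of the paper (column i, row j, 1-based) is the entry
   nth 0 (nth [::] T (j-1)) (i-1). *)
Definition entry (T : seq (seq nat)) (c : nat * nat) : nat :=
  nth 0 (nth [::] T c.2) c.1.

Definition is_SYT (lam : seq nat) (T : seq (seq nat)) : Prop :=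
  [/\ map size T = lam,
      perm_eq (flatten T) (iota 1 (sumn lam)),
      all (sorted ltn) T &
      forall j x, x < nth 0 lam j.+1 ->
        nth 0 (nth [::] T j) x < nth 0 (nth [::] T j.+1) x].

(* cells as 0-based pairs (x, y) = (column - 1, row - 1) *)
Definition cells_of (T : seq (seq nat)) : seq (nat * nat) :=
  flatten [seq [seq (x, y) | x <- iota 0 (size (nth [::] T y))]
          | y <- iota 0 (size T)].

(* order of the content reading word: by increasing content x - y,
   and on each diagonal from southwest to northeast (increasing row) *)
Definition cell_le (a b : nat * nat) : bool :=
  (a.1 + b.2 < b.1 + a.2) || ((a.1 + b.2 == b.1 + a.2) && (a.2 <= b.2)).

Definition reading_word (T : seq (seq nat)) : seq nat :=
  [seq entry T c | c <- sort cell_le (cells_of T)].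

(* descent signature: sign +1 encoded as true, -1 as false;
   meaningful for indices 1 <= i <= n-1 *)
Definition desc_sig (T : seq (seq nat)) (i : nat) : bool :=
  index i (reading_word T) < index i.+1 (reading_word T).

Definition swapv (a b x : nat) : nat :=
  if x == a then b else if x == b then a else x.

Definition ndist (a b : nat) : nat := (a - b) + (b - a).

Definition dual_op (i : nat) (T : seq (seq nat)) : seq (seq nat) :=
  let w := reading_word T in
  let p := index i.-1 w in
  let q := index i w in
  let r := index i.+1 w in
  if ((p < q) && (q < r)) || ((r < q) && (q < p)) then T
  else let k := if ndist r q < ndist p q then i.-1 else i.+1 in
       map (map (swapv i k)) T.

Definition G_edge (i : nat) (T T' : seq (seq nat)) : bool :=
  ((T' == dual_op i T) && (T != T')) || ((T == dual_op i T') && (T != T')).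

(* Signed colored graphs: vertex type V (finite), signature           *)
(* sigma : V -> nat -> bool (only indices 1..N-1 are meaningful,      *)
(* true = +1), edge sets E i : rel V (only 1 < i < n meaningful).     *)
Definition signed_colored_graph (n : nat) (V : finType) (E : nat -> rel V) :=
  forall i, 1 < i < n -> symmetric (E i) /\ irreflexive (E i).

Definition Eunion (V : finType) (E : nat -> rel V) (cols : seq nat) : rel V :=
  fun a b => has (fun k => E k a b) cols.

Definition component (V : finType) (E : nat -> rel V) (cols : seq nat) (v : V)
  : {set V} := [set x | connect (Eunion E cols) v x].

Definition edge_in (V : finType) (spec : seq (nat * V * V)) (k : nat) (a b : V)
  : bool :=
  has (fun t => (t.1.1 == k) &&
         (((t.1.2 == a) && (t.2 == b)) || ((t.1.2 == b) && (t.2 == a)))) spec.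

Definition comp_shape (V : finType) (E : nat -> rel V) (cols : seq nat)
  (C : {set V}) (vs : seq V) (spec : seq (nat * V * V)) : Prop :=
  [/\ uniq vs, C = [set x in vs] &
      forall k a b, k \in cols -> a \in C -> b \in C ->
        E k a b = edge_in spec k a b].

Definition deg_ax1 (n : nat) (V : finType) (sigma : V -> nat -> bool)
  (E : nat -> rel V) :=
  forall i (w : V), 1 < i < n ->
    (sigma w i.-1 != sigma w i <-> exists x, E i w x) /\
    (forall x y, E i w x -> E i w y -> x = y).

Definition deg_ax2 (n N : nat) (V : finType) (sigma : V -> nat -> bool)
  (E : nat -> rel V) :=
  forall i (w x : V), 1 < i < n -> E i w x ->
    [/\ sigma w i.-1 != sigma x i.-1, sigma w i != sigma x i &
        forall h, 1 <= h <= N.-1 -> (h < i - 2) || (i.+1 < h) ->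
          sigma w h = sigma x h].

Definition deg_ax3 (n N : nat) (V : finType) (sigma : V -> nat -> bool)
  (E : nat -> rel V) :=
  forall i (w x : V), 1 < i < n -> E i w x ->
    (2 < i -> sigma w (i - 2) != sigma x (i - 2) ->
       sigma w (i - 2) != sigma w i.-1) /\
    (i.+1 <= N.-1 -> sigma w i.+1 != sigma x i.+1 ->
       sigma w i.+1 != sigma w i).

Definition deg_ax4 (n : nat) (V : finType) (E : nat -> rel V) :=
  (forall i (v : V), 2 < i < n ->
     let cols := [:: i.-1; i] in
     let C := component E cols v in
     (exists x, comp_shape E cols C [:: x] [::]) \/
     (exists x y z, comp_shape E cols C [:: x; y; z]
                      [:: (i.-1, x, y); (i, y, z)]) \/
     (exists x y, comp_shape E cols C [:: x; y]
                      [:: (i.-1, x, y); (i, x, y)])) /\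
  (forall i (v : V), 3 < i < n ->
     let cols := [:: i - 2; i.-1; i] in
     let C := component E cols v in
     (exists x, comp_shape E cols C [:: x] [::]) \/
     (exists p q r s, comp_shape E cols C [:: p; q; r; s]
                      [:: (i - 2, p, q); (i.-1, q, r); (i, r, s)]) \/
     (exists a b c d e, comp_shape E cols C [:: a; b; c; d; e]
                      [:: (i - 2, a, b); (i.-1, a, b); (i, b, c);
                          (i - 2, c, d); (i.-1, d, e); (i, d, e)]) \/
     (exists u v w x y z, comp_shape E cols C [:: u; v; w; x; y; z]
                      [:: (i.-1, u, v); (i - 2, v, w); (i, v, x);
                          (i, w, y); (i - 2, x, y); (i.-1, y, z)])).

Definition deg_ax5 (n : nat) (V : finType) (E : nat -> rel V) :=
  forall i j (w x y : V), 1 < i < n -> 1 < j < n ->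
    (i + 3 <= j) || (j + 3 <= i) -> E i w x -> E j x y ->
    exists v, E j w v /\ E i v y.

Definition deg_ax6 (n : nat) (V : finType) (E : nat -> rel V) :=
  forall i (u w : V), 1 < i < n ->
    connect (Eunion E (iota 2 i.-1)) u w ->
    connect (Eunion E (iota 2 (i - 2))) u w \/
    exists a b, [/\ connect (Eunion E (iota 2 (i - 2))) u a, E i a b &
                    connect (Eunion E (iota 2 (i - 2))) b w].

Definition dual_equivalence_graph (n N : nat) (V : finType)
  (sigma : V -> nat -> bool) (E : nat -> rel V) : Prop :=
  [/\ n <= N, deg_ax1 n sigma E, deg_ax2 n N sigma E, deg_ax3 n N sigma E &
      deg_ax4 n E /\ deg_ax5 n E /\ deg_ax6 n E].

Definition iso_to_G (n : nat) (V : finType) (sigma : V -> nat -> bool)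
  (E : nat -> rel V) (C : {set V}) (lam : seq nat) : Prop :=
  exists f : seq (seq nat) -> V,
    [/\ forall T, is_SYT lam T -> f T \in C,
        forall T T', is_SYT lam T -> is_SYT lam T' -> f T = f T' -> T = T',
        forall x, x \in C -> exists2 T, is_SYT lam T & f T = x,
        forall T j, is_SYT lam T -> 0 < j < n -> sigma (f T) j = desc_sig T j &
        forall T T' i, is_SYT lam T -> is_SYT lam T' -> 1 < i < n ->
          E i (f T) (f T') = G_edge i T T'].

(* Main.v *)
(* A standard tableau is identified with the word of contents of its entries; on
   these words d_i exchanges two letters and the signature records ascents.
   Words are built letter by letter on the vertices of the graph.  The sign
   sigma_m of a vertex depends, within its component for colours < m, only on
   the corner holding m, and by axiom 3 it switches once from + to - as this
   corner moves right; the place of the switch is the cell receiving m+1.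

   It remains to see that an m-edge from v to x acts as d_m.  Write a, b, c for
   the letters m-1, m, m+1 of v and a', b', c' for those of x.  By axiom 5 the
   m-edges commute with the colours <= m-3, so v and x agree on the first m-2
   letters, and these may be replaced by any tableau of the same shape on both
   sides at once.  If c lies between a and b, take for letter m-2 a corner
   between a and b: colours m-1 and m must then form a double edge.  Otherwise a
   lies between b and c, and likewise for x; axiom 3 and the two-colour part of
   axiom 4 give a = a', and the five-vertex components of axiom 4 give b = c'
   and c = b'.  Two cells addable to a shape are always told apart by a corner
   between them, which is how all these equalities are obtained.  Finally axiom
   6 makes the coding injective on components. *)
Require Import Defs.
From mathcomp Require Import all_boot.
From mathcomp Require Import zify.
Set Implicit Arguments. Unset Strict Implicit. Unset Printing Implicit Defensive.

(** * Content words *)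

(* A shape is encoded by its boundary path, a sequence [e] of booleans that is
   eventually [false]: a cell of content c can be added when [e] reads
   (true, false) at c, c+1, and adding it swaps these two values.  Contents are
   shifted by [N] to stay in [nat], so [k <= N] encodes the empty shape.  A
   standard tableau with m cells is the word f 1, ..., f m of the contents of
   its entries; the values of [f] elsewhere are junk. *)
Definition addable (e : nat -> bool) (k : nat) : bool := e k && ~~ e k.+1.

Definition removable (e : nat -> bool) (k : nat) : bool := ~~ e k && e k.+1.

(** With exclusive or, adding and removing a cell of content [c] are one operation, and such
    operations commute and are involutive without side conditions. *)
Definition toggle (c k : nat) : bool := (k == c) (+) (k == c.+1).

Definition flip (e : nat -> bool) (c k : nat) : bool := e k (+) toggle c k.

Fixpoint state (N : nat) (f : nat -> nat) (m : nat) : nat -> bool :=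
  if m is m'.+1 then flip (state N f m') (f m) else fun k => k <= N.

Lemma stateS N f m : state N f m.+1 = flip (state N f m) (f m.+1).
Proof. by []. Qed.

Definition valid (N : nat) (f : nat -> nat) (m : nat) : Prop :=
  forall j, j < m -> addable (state N f j) (f j.+1).

Definition agree (m : nat) (f g : nat -> nat) : bool :=
  all (fun j => f j == g j) (iota 1 m).

Definition transpose (h : nat) (f : nat -> nat) (j : nat) : nat :=
  if j == h then f h.+1 else if j == h.+1 then f h else f j.

Definition between (x y z : nat) : bool := (x < y < z) || (z < y < x).

(** The reading word lists entries by content, so among i-1, i, i+1 the entry of median content is
    also the median by position. If that entry is i nothing happens; otherwise d_i exchanges the two
    outer ones. *)
Definition dual_word (i : nat) (f : nat -> nat) : nat -> nat :=
  let x := f i.-1 in let y := f i in let z := f i.+1 in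
  if between x y z then f
  else if between x z y then transpose i.-1 f else transpose i f.

Definition dual_words (s : seq nat) (f : nat -> nat) : nat -> nat :=
  foldr dual_word f s.

Definition colors (m : nat) (s : seq nat) : bool := all (fun i => 1 < i < m) s.

Lemma agreeP m f g :
  reflect (forall j, 0 < j <= m -> f j = g j) (agree m f g).
Proof.
apply: (iffP allP) => [H j Hj | H j]; last first.
  by rewrite mem_iota => Hj; apply/eqP/H; lia.
by apply/eqP/H; rewrite mem_iota; lia.
Qed.

Lemma agree_refl m f : agree m f f.
Proof. by apply/agreeP. Qed.

Lemma agree_sym m f g : agree m f g -> agree m g f.
Proof. by move=> /agreeP H; apply/agreeP => j /H. Qed.

Lemma agree_trans m f g h : agree m f g -> agree m g h -> agree m f h.
Proof. by move=> /agreeP H /agreeP H'; apply/agreeP => j Hj; rewrite H ?H'. Qed.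

Lemma agree_leq m m' f g : m' <= m -> agree m f g -> agree m' f g.
Proof. by move=> le /agreeP H; apply/agreeP => j Hj; apply: H; lia. Qed.

Lemma agreeS m f g : agree m f g -> f m.+1 = g m.+1 -> agree m.+1 f g.
Proof.
move=> /agreeP H E; apply/agreeP => j Hj.
by have [->//|ne] := eqVneq j m.+1; apply: H; lia.
Qed.

(** * Corners and addable places along a boundary path *)

Lemma crossing (e : nat -> bool) x y : x < y -> ~~ e x -> e y ->
  exists q, [/\ x <= q, q < y & removable e q].
Proof.
elim: y => // y IH xy ex ey.
have [ey'|ey'] := boolP (e y).
  have [eq|ne] := eqVneq x y; first by rewrite eq ey' in ex.
  have [q [q1 q2 q3]] := IH ltac:(lia) ex ey'.
  by exists q; split=> //; lia.
by exists y; split=> //; rewrite /removable ey' ey.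
Qed.

(** The path reads [false] at [a.+1] and [true] at [b], so it crosses upwards in between, and an
    upward crossing is a corner. *)
Lemma removable_between_addable e a b : addable e a -> addable e b -> a < b ->
  exists p, [/\ a < p, p < b & removable e p].
Proof.
move=> /andP[a1 a2] /andP[b1 b2] ab.
have ltb : a.+1 < b.
  by have [eq|ne] := eqVneq b a.+1; [rewrite -eq b1 in a2 | lia].
have [q [q1 q2 q3]] := crossing ltb a2 b1.
by exists q.
Qed.

Lemma addable_neq_removable e a p : addable e a -> removable e p -> a != p.
Proof.
by move=> /andP[a1 a2] /andP[b1 b2]; apply/eqP => E; rewrite E (negbTE b1) in a1.
Qed.

Lemma addable_separated e a b : addable e a -> addable e b ->
  (forall r, removable e r -> (r < a) = (r < b)) -> a = b.
Proof.
move=> ha hb H.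
case: (ltngtP a b) => // ab.
  have [p [p1 p2 /H]] := removable_between_addable ha hb ab; lia.
have [p [p1 p2 /H]] := removable_between_addable hb ha ab; lia.
Qed.

(** Taking away both corners leaves [false] at [a.+1] and [true] at [p]; the upward crossing between
    them is a corner of the smaller shape. *)
Lemma removable_between_removed e a p :
  removable e a -> removable e p -> a < p ->
  exists q, [/\ a < q, q < p & removable (flip (flip e a) p) q].
Proof.
move=> /andP[a1 a2] /andP[p1 p2] ap.
have ne : p != a.+1 by apply/eqP => E; rewrite E a2 in p1.
have [||| q [q1 q2 q3]] := @crossing (flip (flip e a) p) a.+1 p; first lia.
- rewrite /flip /toggle a2.
  have -> : (a.+1 == a) = false by lia.
  have -> : (a.+1 == p) = false by lia.
  have -> : (a.+1 == p.+1) = false by lia.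
  by rewrite eqxx.
- rewrite /flip /toggle (negbTE p1) eqxx.
  have -> : (p == a) = false by lia.
  have -> : (p == a.+1) = false by lia.
  by have -> : (p == p.+1) = false by lia.
by exists q.
Qed.

Lemma eq_addable e e' c : e =1 e' -> addable e c = addable e' c.
Proof. by move=> E; rewrite /addable !E. Qed.

Lemma eq_removable e e' c : e =1 e' -> removable e c = removable e' c.
Proof. by move=> E; rewrite /removable !E. Qed.

Lemma eq_flip e e' c : e =1 e' -> flip e c =1 flip e' c.
Proof. by move=> E k; rewrite /flip E. Qed.

Lemma flipC e a b : flip (flip e a) b =1 flip (flip e b) a.
Proof. by move=> k; rewrite /flip addbAC. Qed.

Lemma flipK e a : flip (flip e a) a =1 e.
Proof. by move=> k; rewrite /flip -addbA addbb addbF. Qed.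

(** For contents differing by at least two the toggled pairs of places are disjoint, so the two
    cells can be added in either order. *)
Definition far (a b : nat) : bool := (a.+1 < b) || (b.+1 < a).

Lemma flip_far e a b : far a b -> (flip e a b = e b) * (flip e a b.+1 = e b.+1).
Proof.
rewrite /far /flip /toggle => H.
have -> : (b == a) = false by lia.
have -> : (b == a.+1) = false by lia.
have -> : (b.+1 == a) = false by lia.
have -> : (b.+1 == a.+1) = false by lia.
by rewrite !addbF.
Qed.

Lemma addable_far e a b : far a b -> addable (flip e a) b = addable e b.
Proof. by move=> H; rewrite /addable !(flip_far _ H). Qed.

Lemma removable_far e a b : far a b -> removable (flip e a) b = removable e b.
Proof. by move=> H; rewrite /removable !(flip_far _ H). Qed.

Lemma far_sym a b : far a b = far b a.
Proof. by rewrite /far orbC. Qed.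

Lemma flip_self e a : (flip e a a = ~~ e a) * (flip e a a.+1 = ~~ e a.+1).
Proof.
rewrite /flip /toggle !eqxx.
have -> : (a == a.+1) = false by lia.
have -> : (a.+1 == a) = false by lia.
by rewrite !addbT.
Qed.

Lemma removable_flip e a : removable (flip e a) a = addable e a.
Proof. by rewrite /removable /addable !flip_self negbK. Qed.

Lemma removable_neq_far e a b : removable e a -> removable e b -> a != b -> far a b.
Proof.
move=> /andP[a1 a2] /andP[b1 b2] ne; rewrite /far.
have n1 : b != a.+1 by apply/eqP => E; rewrite E a2 in b1.
have n2 : a != b.+1 by apply/eqP => E; rewrite E b2 in a1.
lia.
Qed.

(** * Shapes and validity of words, and exchanges of consecutive letters *)

Lemma eq_state N f g m : agree m f g -> state N f m =1 state N g m.
Proof.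
elim: m => // m IH H k /=.
rewrite (agreeP _ _ _ H m.+1) ?leqnn //; apply: eq_flip; apply: IH.
exact: agree_leq H.
Qed.

Lemma eq_valid N f g m : agree m f g -> valid N f m -> valid N g m.
Proof.
move=> H V j jm.
rewrite -(agreeP _ _ _ H) // -(@eq_addable (state N f j)); first exact: V.
by apply: eq_state; apply: agree_leq H; apply: ltnW.
Qed.

Lemma validW N f m m' : m' <= m -> valid N f m -> valid N f m'.
Proof. by move=> le V j Hj; apply: V; apply: leq_trans le. Qed.

Lemma removable_last N f m : valid N f m.+1 -> removable (state N f m.+1) (f m.+1).
Proof. by move=> V; rewrite /= removable_flip; apply: V. Qed.

(** Each new cell extends the disturbed zone of the path by at most one place on either side. As
    long as m <= N, place 0 still reads [true], so the shift by [N] leaves enough room on the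
    left. *)
Lemma state_bounds N f m k : valid N f m ->
  (k + m <= N -> state N f m k) /\ (N + m < k -> ~~ state N f m k).
Proof.
elim: m k => [|m IH] k V; first by split=> /=; lia.
have {}IH k' := IH k' (validW (leqnSn m) V).
have /andP[a1 a2] := V m (ltnSn m).
have [_ I1] := IH (f m.+1); have [I2 _] := IH (f m.+1).+1.
have c1 : f m.+1 <= N + m by rewrite leqNgt; apply/negP => /I1; rewrite a1.
have c2 : N < (f m.+1).+1 + m by rewrite ltnNge; apply: contra a2.
have [J1 J2] := IH k.
split=> H /=; rewrite /flip /toggle.
  have -> : (k == f m.+1) = false by lia.
  have -> : (k == (f m.+1).+1) = false by lia.
  by rewrite !addbF; apply: J1; lia.
have -> : (k == f m.+1) = false by lia.
have -> : (k == (f m.+1).+1) = false by lia.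
by rewrite !addbF; apply: J2; lia.
Qed.

Lemma valid_neq1 N f m i : valid N f m -> 0 < i < m -> f i != f i.+1.
Proof.
move=> V Hi; have H := V i ltac:(lia).
have R : removable (state N f i) (f i).
  by case: i Hi H => // i Hi _; apply: removable_last; apply: validW V; lia.
by rewrite eq_sym; apply: addable_neq_removable H R.
Qed.

(** Between two cells of one diagonal both neighbouring contents must occur, and a single
    intermediate letter supplies only one of them. *)
Lemma valid_neq2 N f m i : valid N f m -> 1 < i < m -> f i.-1 != f i.+1.
Proof.
case: i => [|[|i]] // V Hi /=; apply/eqP => E.
have A1 := V i ltac:(lia); have A3 := V i.+2 ltac:(lia).
have n1 : f i.+1 != f i.+2 by apply: (valid_neq1 V); lia.
move: A3; rewrite -E /= /addable.
move: A1 => /andP[a1 a2].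
rewrite /flip /toggle a1 (negbTE a2) !eqxx.
have -> : (f i.+1 == (f i.+1).+1) = false by lia.
have -> : (f i.+1 == f i.+2) = false by lia.
have -> : ((f i.+1).+1 == f i.+1) = false by lia.
have -> : ((f i.+1).+1 == (f i.+2).+1) = false by lia.
by rewrite /= addbF; lia.
Qed.

Lemma transposeE h f :
  (transpose h f h = f h.+1) * (transpose h f h.+1 = f h) *
  (forall j, j != h -> j != h.+1 -> transpose h f j = f j).
Proof.
rewrite /transpose !eqxx; have -> : (h.+1 == h) = false by lia.
by split=> // j /negbTE-> /negbTE->.
Qed.

Lemma state_transpose_low N h f m : m < h -> state N (transpose h f) m =1 state N f m.
Proof.
by move=> H; apply: eq_state; apply/agreeP => j Hj; rewrite transposeE; lia.
Qed.

Lemma state_transpose N (h : nat) f m : h != m -> state N (transpose h.+1 f) m.+1 =1 state N f m.+1.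
Proof.
elim: m => [|m IH] hm k; first by apply: state_transpose_low; lia.
have [hm'|hm'] := ltnP m.+1 h; first by apply: state_transpose_low; lia.
have [E|ne] := eqVneq h m.
  subst h; rewrite [LHS]/= [RHS]/= !transposeE flipC.
  by do 2!apply: eq_flip; apply: state_transpose_low.
have [ltm|] := ltnP h m.+1; last by move=> hh; lia.
rewrite !(stateS _ _ m.+1) transposeE; [|lia|lia].
by apply: eq_flip; apply: IH.
Qed.

Lemma valid_transpose N h f m : valid N f m -> h.+1 < m -> far (f h.+1) (f h.+2) ->
  valid N (transpose h.+1 f) m.
Proof.
move=> V hm F j jm.
have Vh := V h ltac:(lia); have Vh1 := V h.+1 hm.
have [E|n1] := eqVneq j h.
  rewrite E transposeE (eq_addable _ (state_transpose_low N f (ltnSn h))).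
  by rewrite -(addable_far _ F).
have [E|n2] := eqVneq j h.+1.
  rewrite E transposeE /= transposeE.
  rewrite (eq_addable _ (eq_flip _ (state_transpose_low N f (ltnSn h)))).
  by rewrite addable_far // far_sym.
rewrite transposeE; [|lia|lia].
rewrite (@eq_addable _ (state N f j)); first exact: V.
case: j jm n1 n2 => [|j] jm n1 n2; first exact: state_transpose_low.
by apply: state_transpose; lia.
Qed.

Lemma removable_between e a p : removable e a -> removable e p -> a != p ->
  exists q, between a q p /\ removable (flip (flip e a) p) q.
Proof.
move=> ha hp; rewrite neq_ltn => /orP[ap|pa].
  have [q [q1 q2 q3]] := removable_between_removed ha hp ap.
  by exists q; rewrite /between q1 q2.
have [q [q1 q2 q3]] := removable_between_removed hp ha pa.
by exists q; rewrite /between q1 q2 orbT (eq_removable _ (flipC e a p)).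
Qed.

(** Corners and addable places alternate, and the outermost ones are addable because the path starts
    at [true] and ends at [false]. A sign on corners that switches at most once, from [true] to
    [false], therefore switches at an addable place. *)
Lemma addable_threshold (e : pred nat) M (s : pred nat) : e 0 -> (forall k, M < k -> ~~ e k) ->
  (forall c d, removable e c -> removable e d -> c < d -> ~~ s c -> ~~ s d) ->
  exists A, addable e A /\ forall r, removable e r -> s r = (r < A).
Proof.
move=> e0 eM mono.
(* [t] is one past the rightmost corner of sign [true], or 0 if there is none; the path reads [true]
   there. *)
have [t [et lo hi]] : exists t, [/\ e t, forall r, removable e r -> r < t -> s r
    & forall r, removable e r -> t <= r -> ~~ s r].
  have [ex|nex] := boolP (has (fun r => removable e r && s r) (iota 0 M)).
    have ex' : exists r, removable e r && s r.
      by move/hasP: ex => [r _ Hr]; exists r.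
    have bd r : removable e r && s r -> r <= M.
      move=> /andP[/andP[_ er] _]; rewrite leqNgt; apply/negP => Mr.
      by move: (eM r.+1 ltac:(lia)); rewrite er.
    case: (ex_maxnP ex' bd) => r /andP[rr sr] maxr.
    exists r.+1; split=> [|r' rr' le|r' rr' lt]; first by case/andP: rr.
      have [->//|ne] := eqVneq r' r.
      apply/negPn/negP => ns; move: sr; apply/negP; apply: (mono r') => //; lia.
    by apply/negP => sr'; move: (maxr r'); rewrite rr' sr' => /(_ isT); lia.
  exists 0; split=> // r rr _; apply/negP => sr; move/hasPn: nex => /(_ r).
  rewrite rr sr mem_iota; case/andP: rr => _ er.
  have : r.+1 <= M by rewrite leqNgt; apply/negP => /eM; rewrite er.
  by move=> rM /(_ ltac:(lia)).
(* [A] is the end of the run of [true] containing [t], so no corner [r] satisfies t <= r < A. *)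
have ex : exists k, (t <= k) && ~~ e k.+1 by exists (t + M); rewrite leq_addr eM //; lia.
case: (ex_minnP ex) => A /andP[tA eA] minA.
have tr k : t <= k -> k <= A -> e k.
  move=> tk kA; have [<-//|ne] := eqVneq t k.
  case: k tk kA ne => [|k] tk kA ne; first lia.
  by apply/negPn/negP => nek; move: (minA k); rewrite nek andbT => /(_ ltac:(lia)); lia.
exists A; split=> [|r rr]; first by rewrite /addable eA tr.
have [rt|tr'] := ltnP r t; first by rewrite lo //; lia.
rewrite (negbTE (hi _ rr tr')); apply/esym/negbTE; rewrite -leqNgt leqNgt.
by apply/negP => rA; case/andP: rr; rewrite tr //; lia.
Qed.

(** * The involutions d_i on words *)

Lemma dual_word_fix i f :
  between (f i.-1) (f i) (f i.+1) -> dual_word i f = f.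
Proof. by rewrite /dual_word => ->. Qed.

Lemma dual_word_low i f :
  between (f i.-1) (f i.+1) (f i) -> dual_word i f = transpose i.-1 f.
Proof.
rewrite /dual_word => H; rewrite H ifF //.
by apply/negbTE; move: H; rewrite /between; lia.
Qed.

Lemma dual_word_high i f :
  between (f i) (f i.-1) (f i.+1) -> dual_word i f = transpose i f.
Proof.
rewrite /dual_word => H; rewrite !ifF //; apply/negbTE; move: H; rewrite /between; lia.
Qed.

Lemma dual_wordP N f m i : valid N f m -> 1 < i < m ->
  [\/ between (f i.-1) (f i) (f i.+1) /\ dual_word i f = f,
      between (f i.-1) (f i.+1) (f i) /\ dual_word i f = transpose i.-1 f |
      between (f i) (f i.-1) (f i.+1) /\ dual_word i f = transpose i f].
Proof.
move=> V Hi.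
have n1 : f i.-1 != f i.
  by have := valid_neq1 V (_ : 0 < i.-1 < m); rewrite prednK; [apply; lia | lia].
have n2 : f i != f i.+1 by apply: (valid_neq1 V); lia.
have n3 : f i.-1 != f i.+1 by apply: (valid_neq2 V).
have : [|| between (f i.-1) (f i) (f i.+1), between (f i.-1) (f i.+1) (f i)
     | between (f i) (f i.-1) (f i.+1)] by rewrite /between; lia.
case/or3P => H.
- by apply: Or31; rewrite dual_word_fix.
- by apply: Or32; rewrite dual_word_low.
- by apply: Or33; rewrite dual_word_high.
Qed.

Lemma dual_word_out i f j : (j < i.-1) || (i.+1 < j) -> 1 < i -> dual_word i f j = f j.
Proof.
move=> Hj i1; rewrite /dual_word; case: ifP => // _.
by case: ifP => _; rewrite transposeE; lia.
Qed.

Lemma agree_transpose m f g h : 0 < h < m -> agree m f g ->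
  agree m (transpose h f) (transpose h g).
Proof.
move=> Hh /agreeP H; apply/agreeP => j Hj; rewrite /transpose.
by case: ifP => [/eqP E|_]; [|case: ifP => [/eqP E|_]]; apply: H; lia.
Qed.

Lemma agree_dual m f g i : 1 < i < m -> agree m f g ->
  agree m (dual_word i f) (dual_word i g).
Proof.
move=> Hi A; move/agreeP: (A) => H; rewrite /dual_word !H; try lia.
case: ifP => // _; case: ifP => _; apply: agree_transpose => //; lia.
Qed.

(** The two exchanged letters have the third one strictly between them, hence are far apart and may
    be added in either order. *)
Lemma valid_dual N f m i : valid N f m -> 1 < i < m ->
  valid N (dual_word i f) m /\ state N (dual_word i f) m =1 state N f m.
Proof.
move=> V Hi; have [[_ ->]//|[B ->]|[B ->]] := dual_wordP V Hi.
  case: i Hi B => [|[|i]] // Hi B; split.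
    by apply: valid_transpose => //; [lia | move: B; rewrite /between /far /=; lia].
  by case: m Hi V => [|m] Hi V; [lia | apply: state_transpose; lia].
case: i Hi B => [|i] // Hi B; split.
  by apply: valid_transpose => //; [lia | move: B; rewrite /between /far /=; lia].
by case: m Hi V => [|m] Hi V; [lia | apply: state_transpose; lia].
Qed.

Lemma colors_cons m i s : colors m (i :: s) = (1 < i < m) && colors m s.
Proof. by []. Qed.

Lemma colors_leq m m' s : m <= m' -> colors m s -> colors m' s.
Proof. by move=> le; apply: sub_all => i; lia. Qed.

Lemma colors_cat m s t : colors m (s ++ t) = colors m s && colors m t.
Proof. exact: all_cat. Qed.

Lemma colors_rev m s : colors m (rev s) = colors m s.
Proof. exact: all_rev. Qed.

Lemma dual_words_cat s t f : dual_words (s ++ t) f = dual_words s (dual_words t f).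
Proof. exact: foldr_cat. Qed.

Lemma agree_duals m f g s : colors m s -> agree m f g ->
  agree m (dual_words s f) (dual_words s g).
Proof.
by elim: s => //= i s IH /andP[Hi Hs] A; apply: agree_dual => //; apply: IH.
Qed.

Lemma dual_words_out m s f j : colors m s -> m < j -> dual_words s f j = f j.
Proof.
move=> Hs mj; elim: s Hs => //= i s IH /andP[Hi Hs].
by rewrite dual_word_out ?IH //; lia.
Qed.

Lemma valid_duals N f m s : valid N f m -> colors m s ->
  valid N (dual_words s f) m /\ state N (dual_words s f) m =1 state N f m.
Proof.
move=> V; elim: s => //= i s IH /andP[Hi /IH[V' S']].
have [V'' S''] := valid_dual V' Hi; split=> // k; by rewrite S'' S'.
Qed.

(** * Words with prescribed last letters, and connectedness of the words of one shape *)

Definition snoc (f : nat -> nat) (m c j : nat) : nat := if j == m.+1 then c else f j.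

Lemma snoc_last f m c : snoc f m c m.+1 = c.
Proof. by rewrite /snoc eqxx. Qed.

Lemma snoc_agree f m c : agree m (snoc f m c) f.
Proof. by apply/agreeP => j Hj; rewrite /snoc ifF //; lia. Qed.

Lemma state_snoc N f m c : state N (snoc f m c) m.+1 =1 flip (state N f m) c.
Proof.
by rewrite stateS snoc_last; apply: eq_flip; apply: eq_state; apply: snoc_agree.
Qed.

Lemma valid_snoc N f m c : valid N f m -> addable (state N f m) c ->
  valid N (snoc f m c) m.+1.
Proof.
move=> V A j; rewrite ltnS leq_eqVlt => /orP[/eqP->|jm].
  by rewrite snoc_last (eq_addable _ (eq_state N (snoc_agree f m c))).
exact: (eq_valid (agree_sym (snoc_agree f m c)) V).
Qed.

(** Every corner can hold the largest entry. If the last letter lies elsewhere, [r] was already a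
    corner one step earlier: the prefix is rearranged to end in [r], and the last two letters, being
    far apart, are exchanged. *)
Lemma ex_last_removable N f m r : valid N f m -> removable (state N f m) r ->
  exists g, [/\ valid N g m, state N g m =1 state N f m, g m = r & 0 < m].
Proof.
elim: m f r => [|m IH] f r V R; first by move: R; rewrite /removable /=; lia.
have [E|ne] := eqVneq (f m.+1) r; first by exists f.
have F := removable_neq_far (removable_last V) R ne.
have R' : removable (state N f m) r by rewrite -(removable_far _ F).
have [g [Vg Sg gm m0]] := IH f r (validW (leqnSn m) V) R'.
have Vs : valid N (snoc g m (f m.+1)) m.+1.
  by apply: valid_snoc; rewrite // (eq_addable _ Sg); apply: V.
case: m m0 gm {IH} V F R R' Vg Sg ne Vs => // m _ gm V F R R' Vg Sg ne Vs.
have gE : snoc g m.+1 (f m.+2) m.+1 = r by rewrite /snoc ifF //; lia.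
exists (transpose m.+1 (snoc g m.+1 (f m.+2))); split=> //.
- by apply: valid_transpose => //; rewrite gE snoc_last far_sym.
- move=> k; rewrite state_transpose; last lia.
  by rewrite state_snoc (eq_flip _ Sg).
- by rewrite transposeE gE.
Qed.

(** On such a word d_{m-1} exchanges the last two letters; this links the words ending in [a] to
    those ending in [p]. *)
Lemma ex_last_two_removable N f m a p : valid N f m ->
  removable (state N f m) a -> removable (state N f m) p -> a != p ->
  exists k g, [/\ m = k.+3, valid N g m, state N g m =1 state N f m &
    [/\ g k.+3 = a, g k.+2 = p & between a (g k.+1) p]].
Proof.
move=> V Ra Rp ne.
have [q [Bq Rq]] := removable_between Ra Rp ne.
have [g1 [V1 S1 g1m m0]] := ex_last_removable V Ra.
case: m m0 V Ra Rp Rq V1 S1 g1m => // m _ V Ra Rp Rq V1 S1 g1m.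
have S1' : state N g1 m =1 flip (state N f m.+1) a.
  by move=> k; rewrite -(eq_flip a S1) stateS g1m flipK.
have Rp' : removable (state N g1 m) p.
  by rewrite (eq_removable _ S1') removable_far // (removable_neq_far Ra Rp).
have [g2 [V2 S2 g2m m0]] := ex_last_removable (validW (leqnSn m) V1) Rp'.
case: m m0 V Ra Rp Rq V1 S1 g1m S1' Rp' V2 S2 g2m => // m _ V Ra Rp Rq V1 S1 g1m S1' Rp' V2 S2 g2m.
have S2' : state N g2 m =1 flip (flip (state N f m.+2) a) p.
  by move=> k; rewrite -(eq_flip _ S1') -(eq_flip p S2) stateS g2m flipK.
have Rq' : removable (state N g2 m) q by rewrite (eq_removable _ S2').
have [g3 [V3 S3 g3m m0]] := ex_last_removable (validW (leqnSn m) V2) Rq'.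
case: m m0 V Ra Rp Rq V1 S1 g1m S1' Rp' V2 S2 g2m S2' Rq' V3 S3 g3m => // m _ V Ra Rp Rq V1 S1 g1m S1' Rp' V2 S2 g2m S2' Rq' V3 S3 g3m.
have V4 : valid N (snoc g3 m.+1 p) m.+2.
  by apply: valid_snoc; rewrite // (eq_addable _ S3) -g2m; apply: V2.
have S4 : state N (snoc g3 m.+1 p) m.+2 =1 state N g1 m.+2.
  by move=> k; rewrite state_snoc (eq_flip _ S3) -S2 -g2m.
exists m, (snoc (snoc g3 m.+1 p) m.+2 a); split=> //.
- by apply: valid_snoc; rewrite // (eq_addable _ S4) -g1m; apply: V1.
- by move=> k; rewrite state_snoc (eq_flip _ S4) -S1 -g1m.
split; first exact: snoc_last.
  by rewrite /snoc eqxx ifF //; lia.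
rewrite /snoc !ifF ?g3m //; lia.
Qed.

(** Words with the same last letter are joined by induction on their prefixes. Otherwise the route
    passes through a word ending in the last letters of [g] and [f], in this order, with a letter
    between them just before; d_{m-1} exchanges these two. *)
Lemma dual_words_connected N f g m : valid N f m -> valid N g m ->
  state N f m =1 state N g m -> exists2 s, colors m s & agree m (dual_words s f) g.
Proof.
elim: m f g => [|m IH] f g Vf Vg S; first by exists [::].
have same f' g' : valid N f' m.+1 -> valid N g' m.+1 ->
    state N f' m.+1 =1 state N g' m.+1 -> f' m.+1 = g' m.+1 ->
    exists2 s, colors m.+1 s & agree m.+1 (dual_words s f') g'.
  move=> Vf' Vg' S' E.
  have [||k|s Cs As] := IH f' g'.
  - exact: validW Vf'.
  - exact: validW Vg'.
  - by rewrite -[LHS](flipK _ (f' m.+1)) -[RHS](flipK _ (g' m.+1)) -!stateS (eq_flip _ S') E.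
  exists s; first exact: colors_leq Cs.
  by apply: agreeS => //; rewrite (dual_words_out _ Cs).
have [E|ne] := eqVneq (f m.+1) (g m.+1); first exact: same.
have Ra := removable_last Vf.
have Rb : removable (state N f m.+1) (g m.+1).
  by rewrite (eq_removable _ S); apply: removable_last.
have [k [h [Em Vh Sh [h3 h2 h1]]]] := ex_last_two_removable Vf Ra Rb ne.
case: Em => Em; subst m.
have [s1 C1 A1] : exists2 s, colors k.+3 s & agree k.+3 (dual_words s f) h.
  by apply: same => // j; rewrite Sh.
have Hi : 1 < k.+2 < k.+3 by lia.
have [V2 S2] := valid_dual Vh Hi.
have L2 : dual_word k.+2 h k.+3 = g k.+3.
  rewrite dual_word_high ?transposeE //= h2 h3.
  by move: h1; rewrite /between orbC.
have [s2 C2 A2] : exists2 s, colors k.+3 s & agree k.+3 (dual_words s (dual_word k.+2 h)) g.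
  by apply: same => // j; rewrite S2 Sh S.
exists (s2 ++ k.+2 :: s1); first by rewrite colors_cat C2 colors_cons C1 Hi.
rewrite dual_words_cat; apply: agree_trans A2; apply: agree_duals => //=.
exact: agree_dual.
Qed.

Definition ascent (f : nat -> nat) (h : nat) : bool := f h < f h.+1.

(* A word is determined by the signatures met along its dual equivalence
   orbit: these compare its last letter with every corner of the shape of its
   prefix, and distinct addable cells are separated by corners. *)
Lemma rigid N f g m : valid N f m -> valid N g m ->
  (forall s h, colors m s -> 0 < h < m ->
     ascent (dual_words s f) h = ascent (dual_words s g) h) ->
  agree m f g.
Proof.
elim: m => // m IH Vf Vg H.
have A : agree m f g.
  apply: IH; [exact: validW Vf | exact: validW Vg |].
  by move=> s h Cs Hh; apply: H; [apply: colors_leq Cs | lia].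
apply: agreeS => //; apply: (@addable_separated (state N f m)); first exact: Vf.
  by rewrite (eq_addable _ (eq_state N A)); apply: Vg.
move=> r Rr.
have Vf' := validW (leqnSn m) Vf.
have [u [Vu Su um m0]] := ex_last_removable Vf' Rr.
have [|s Cs As] := dual_words_connected Vf' Vu; first by move=> k; rewrite Su.
have := H s m (colors_leq (leqnSn m) Cs) ltac:(lia).
have Em : dual_words s f m = r by rewrite (agreeP _ _ _ As) // m0 leqnn.
have Em' : dual_words s g m = r.
  by rewrite -(agreeP _ _ _ (agree_duals Cs A)) // m0 leqnn.
by rewrite /ascent !(dual_words_out _ Cs (ltnSn m)) Em Em'.
Qed.

Lemma dual_wordK N f m i : valid N f m -> 1 < i < m ->
  agree m (dual_word i (dual_word i f)) f.
Proof.
case: i => [|i] // V Hi; have := dual_wordP V Hi; rewrite [i.+1.-1]/=.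
have tK h : transpose h (transpose h f) =1 f.
  move=> j; rewrite /transpose eqxx; have -> : (h.+1 == h) = false by lia.
  by rewrite eqxx; case: eqP => [->//|_]; case: eqP => [->|].
case=> -[B D].
- by rewrite !D agree_refl.
- rewrite D dual_word_low /=.
    by apply/agreeP => j _; apply: tK.
  by rewrite !transposeE ?[transpose _ _ i.+2]transposeE; move: B; rewrite /between; lia.
rewrite D dual_word_high /=.
  by apply/agreeP => j _; apply: tK.
by rewrite !transposeE ?[transpose _ _ i]transposeE; move: B; rewrite /between; lia.
Qed.

(** * Dual equivalence graphs *)

(* [lia] on the arithmetic hypotheses only: it blows up on contexts full of
   opaque boolean atoms. *)
Ltac is_arith P :=
  lazymatch P with
  | is_true (leq _ _) => idtac
  | is_true (leq _ _ && leq _ _) => idtac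
  | is_true (~~ (@eq_op _ _ _)) => idtac
  | @eq nat _ _ => idtac
  end.

Ltac nlia :=
  repeat match goal with
    | H : ?P |- _ =>
      lazymatch type of P with Prop => idtac end;
      tryif is_arith P then fail else clear H
    end; lia.

Lemma between_sym x y z : between x y z = between z y x.
Proof. by rewrite /between orbC. Qed.

Section DualEquivalenceGraph.

Variables (n : nat) (V : finType) (sigma : V -> nat -> bool) (E : nat -> rel V).
Hypothesis graphE : signed_colored_graph n E.
Hypothesis ax1 : deg_ax1 n sigma E.
Hypothesis ax2 : deg_ax2 n n sigma E.
Hypothesis ax3 : deg_ax3 n n sigma E.
Hypothesis ax4 : deg_ax4 n E.
Hypothesis ax5 : deg_ax5 n E.
Hypothesis ax6 : deg_ax6 n E.

(** The default [v] makes this a total involution, as d_i is on words: a vertex without an edge of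
    colour [i] is fixed. *)
Definition neighbor (i : nat) (v : V) : V := odflt v [pick x | E i v x].

Definition acts (s : seq nat) (v : V) : V := foldr neighbor v s.

Lemma edge_sym i u v : 1 < i < n -> E i u v -> E i v u.
Proof. by move=> Hi; have [S _] := graphE Hi; rewrite S. Qed.

Lemma neighborE i v x : 1 < i < n -> E i v x -> neighbor i v = x.
Proof.
move=> Hi e; rewrite /neighbor; case: pickP => [y e'|/(_ x)]; last by rewrite e.
by have [_ U] := ax1 v Hi; apply: U e' e.
Qed.

Lemma edge_sigma i v x : 1 < i < n -> E i v x -> sigma v i.-1 != sigma v i.
Proof. by move=> Hi e; have [[_ H] _] := ax1 v Hi; apply: H; exists x. Qed.

Lemma edge_neighbor i v : 1 < i < n -> sigma v i.-1 != sigma v i ->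
  E i v (neighbor i v).
Proof.
move=> Hi ne; have [[H _] _] := ax1 v Hi; have [x e] := H ne.
by rewrite (neighborE Hi e).
Qed.

Lemma neighbor_id i v : 1 < i < n -> sigma v i.-1 = sigma v i -> neighbor i v = v.
Proof.
move=> Hi eq; rewrite /neighbor; case: pickP => // x e.
by move: (edge_sigma Hi e); rewrite eq eqxx.
Qed.

Lemma edge_or_fixed i v : 1 < i < n -> E i v (neighbor i v) \/
  (neighbor i v = v /\ sigma v i.-1 = sigma v i).
Proof.
move=> Hi; have [eq|ne] := eqVneq (sigma v i.-1) (sigma v i).
  by right; rewrite neighbor_id.
by left; apply: edge_neighbor.
Qed.

Lemma neighborK i v : 1 < i < n -> neighbor i (neighbor i v) = v.
Proof.
move=> Hi; have [e|[eq _]] := edge_or_fixed v Hi; last by rewrite !eq.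
by apply: neighborE => //; apply: edge_sym.
Qed.

Lemma acts_cat s t v : acts (s ++ t) v = acts s (acts t v).
Proof. exact: foldr_cat. Qed.

Lemma acts_revK s v : colors n s -> acts (rev s) (acts s v) = v.
Proof.
elim: s v => //= i s IH v /andP[Hi Hs].
by rewrite rev_cons -cats1 acts_cat /= neighborK // IH.
Qed.

Lemma connectP_acts m u v : m <= n ->
  connect (Eunion E (iota 2 (m - 2))) u v <-> exists2 s, colors m s & v = acts s u.
Proof.
move=> mn; split=> [/connectP[p]|[s]].
  elim: p u => [|x p IH] u /=; first by move=> _ ->; exists [::].
  case/andP=> /hasP[i]; rewrite mem_iota => Hi e pp lp.
  have [s Cs ->] := IH _ pp lp.
  exists (s ++ [:: i]); first by rewrite colors_cat Cs /colors /= andbT; nlia.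
  by rewrite acts_cat /= (neighborE _ e) //; nlia.
elim: s v => [|i s IH] v /=; first by move=> _ ->; exact: connect0.
case/andP=> Hi /IH H ->; apply: connect_trans (H _ erefl) _.
have Hi' : 1 < i < n by nlia.
have [e|[-> _]] := edge_or_fixed (acts s u) Hi'; last exact: connect0.
by apply/connect1/hasP; exists i => //; rewrite mem_iota; nlia.
Qed.

Lemma sigma_neighbor i v h : 1 < i < n -> 0 < h < n ->
  (h < i - 2) || (i.+1 < h) -> sigma (neighbor i v) h = sigma v h.
Proof.
move=> Hi Hh far; have [e|[-> _]//] := edge_or_fixed v Hi.
by have [_ _ H] := ax2 Hi e; rewrite H //; nlia.
Qed.

Lemma sigma_acts m s v h : colors m s -> m < h < n -> sigma (acts s v) h = sigma v h.
Proof.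
move=> Cs Hh; elim: s Cs => //= i s IH /andP[Hi /IH <-].
by rewrite sigma_neighbor //; nlia.
Qed.

(** Axiom 5 applies when [v] has an edge of colour [j]. When it has none, axiom 2 gives [x] the same
    signs at j-1 and j, so [x] has none either. *)
Lemma edge_commute m j v x : m < n -> 1 < j -> j + 3 <= m -> E m v x ->
  E m (neighbor j v) (neighbor j x).
Proof.
move=> mn j1 jm e; have Hm : 1 < m < n by nlia.
have Hj : 1 < j < n by nlia.
have [_ _ S] := ax2 Hm e.
have [ej|[-> eq]] := edge_or_fixed v Hj.
  have [z [e1 e2]] := ax5 Hj Hm ltac:(nlia) (edge_sym Hj ej) e.
  by rewrite (neighborE Hj (edge_sym Hj e2)).
by rewrite (@neighbor_id j x) // -!S //; nlia.
Qed.

Lemma edge_acts m s v x : m < n -> colors (m - 2) s -> E m v x ->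
  E m (acts s v) (acts s x).
Proof.
move=> mn Cs e; elim: s Cs => //= i s IH /andP[Hi /IH e'].
by apply: edge_commute => //; nlia.
Qed.

(** * Components for two and three consecutive colours *)

Lemma component_edge cols v x y k : k \in cols -> x \in component E cols v ->
  E k x y -> y \in component E cols v.
Proof.
rewrite !inE => kc vx e; apply: connect_trans vx _.
by apply/connect1/hasP; exists k.
Qed.

Lemma edge_in_shape cols v vs spec k x y : comp_shape E cols (component E cols v) vs spec ->
  k \in cols -> x \in component E cols v -> E k x y -> edge_in spec k x y.
Proof.
by move=> [_ _ H] kc xC e; rewrite -H //; apply: component_edge e.
Qed.

Lemma shape_in_edge cols v vs spec k x y : comp_shape E cols (component E cols v) vs spec ->
  k \in cols -> x \in vs -> y \in vs -> edge_in spec k x y -> E k x y.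
Proof.
by move=> [_ C H] kc xC yC; rewrite H // C inE.
Qed.

Lemma edge_inP (spec : seq (nat * V * V)) k a b :
  edge_in spec k a b -> exists t, [/\ t \in spec, t.1.1 = k &
    (t.1.2 = a /\ t.2 = b) \/ (t.1.2 = b /\ t.2 = a)].
Proof.
case/hasP=> t ts /andP[/eqP k1 /orP[]/andP[/eqP e1 /eqP e2]]; exists t; split; auto.
Qed.

(** Locates an edge in the explicit list of a component: one goal for each entry of the right colour
    and each orientation. *)
Ltac split_edge e :=
  let t := fresh "t" in let ts := fresh "ts" in let tk := fresh "tk" in
  let te := fresh "te" in
  have [t [ts tk te]] := edge_inP e;
  move: ts; rewrite !inE; repeat (case/orP); move/eqP=> ts; subst t; simpl in tk, te;
  try (match type of tk with ?a = ?b =>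
         match goal with N : a <> b |- _ => case (N tk) end end);
  destruct te as [[? ?]|[? ?]]; clear tk.

Ltac split_uniq U :=
  move: U; rewrite /= !inE ?negb_or => U;
  repeat match goal with
    | H : is_true (_ && _) |- _ => case/andP: H => ? ?
    end;
  repeat match goal with
    | H : is_true (_ != _) |- _ => move/eqP in H
    end.

(** A vertex meeting both colours lies on a double edge or in the middle of a path. To obtain a
    double edge it thus suffices that one of the outer vertices carries the other colour. *)
Lemma two_color i x y z : 2 < i < n -> E i.-1 y x -> E i y z ->
  x = z \/ (forall t, ~~ E i x t) /\ (forall t, ~~ E i.-1 z t).
Proof.
move=> Hi e1 e2; have [H _] := ax4.
have N1 : i.-1 <> i by nlia.
have N2 := not_eq_sym N1.
have k1 : i.-1 \in [:: i.-1; i] by rewrite !inE eqxx.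
have k2 : i \in [:: i.-1; i] by rewrite !inE eqxx orbT.
have yC : y \in component E [:: i.-1; i] y by rewrite inE connect0.
have xC := component_edge k1 yC e1; have zC := component_edge k2 yC e2.
case: (H i y Hi) => [[x0 S]|[[x0 [y0 [z0 S]]]|[x0 [y0 S]]]].
- by have := edge_in_shape S k1 yC e1.
- have i1 := edge_in_shape S k1 yC e1; have i2 := edge_in_shape S k2 yC e2.
  have [U _ _] := S; split_uniq U.
  split_edge i1; split_edge i2; subst; try congruence; right; split=> t; apply/negP => e3.
    by have i3 := edge_in_shape S k2 xC e3; split_edge i3; congruence.
  by have i3 := edge_in_shape S k1 zC e3; split_edge i3; congruence.
- have i1 := edge_in_shape S k1 yC e1; have i2 := edge_in_shape S k2 yC e2.
  have [U _ _] := S; split_uniq U.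
  split_edge i1; split_edge i2; left; congruence.
Qed.

(** A double edge of colours i-2, i-1 occurs only in the five-vertex component, whose remaining
    vertices are then reached in order. *)
Lemma three_color i a b c : 3 < i < n ->
  E (i - 2) a b -> E i.-1 a b -> E i b c ->
  exists d e, [/\ E (i - 2) c d, E i.-1 d e & E i d e].
Proof.
move=> Hi e1 e2 e3; have [_ H] := ax4.
have N1 : i.-1 <> i by nlia.
have N2 := not_eq_sym N1.
have N3 : i - 2 <> i by nlia.
have N4 := not_eq_sym N3.
have N5 : i - 2 <> i.-1 by nlia.
have N6 := not_eq_sym N5.
have k1 : i - 2 \in [:: i - 2; i.-1; i] by rewrite !inE eqxx.
have k2 : i.-1 \in [:: i - 2; i.-1; i] by rewrite !inE eqxx orbT.
have k3 : i \in [:: i - 2; i.-1; i] by rewrite !inE eqxx !orbT.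
have aC : a \in component E [:: i - 2; i.-1; i] a by rewrite inE connect0.
have bC := component_edge k1 aC e1.
case: (H i a Hi) => [[x0 S]|[[p [q [r [s S]]]]|
  [[x1 [x2 [x3 [x4 [x5 S]]]]]|[u [v [w [x [y [z S]]]]]]]]].
- by have := edge_in_shape S k1 aC e1.
- have i1 := edge_in_shape S k1 aC e1; have i2 := edge_in_shape S k2 aC e2.
  have [U _ _] := S; split_uniq U.
  by split_edge i1; split_edge i2; congruence.
- have i1 := edge_in_shape S k1 aC e1; have i2 := edge_in_shape S k2 aC e2.
  have i3 := edge_in_shape S k3 bC e3.
  have [U _ _] := S; split_uniq U.
  have I4 : E (i - 2) x3 x4.
    by apply: (shape_in_edge S) => //; rewrite ?inE /edge_in /= ?eqxx ?orbT.
  have I5 : E i.-1 x4 x5.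
    by apply: (shape_in_edge S) => //; rewrite ?inE /edge_in /= ?eqxx ?orbT.
  have I6 : E i x4 x5.
    by apply: (shape_in_edge S) => //; rewrite ?inE /edge_in /= ?eqxx ?orbT.
  suff -> : c = x3 by exists x4, x5.
  by split_edge i1; split_edge i2; try congruence; split_edge i3; congruence.
- have i1 := edge_in_shape S k1 aC e1; have i2 := edge_in_shape S k2 aC e2.
  have [U _ _] := S; split_uniq U.
  by split_edge i1; split_edge i2; congruence.
Qed.

(** The same five-vertex component, entered from its other double edge. *)
Lemma three_color_rev i c d e : 3 < i < n ->
  E i.-1 d e -> E i d e -> E (i - 2) d c ->
  exists b a, [/\ E i c b, E (i - 2) a b & E i.-1 a b].
Proof.
move=> Hi e1 e2 e3; have [_ H] := ax4.
have N1 : i.-1 <> i by nlia.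
have N2 := not_eq_sym N1.
have N3 : i - 2 <> i by nlia.
have N4 := not_eq_sym N3.
have N5 : i - 2 <> i.-1 by nlia.
have N6 := not_eq_sym N5.
have k1 : i - 2 \in [:: i - 2; i.-1; i] by rewrite !inE eqxx.
have k2 : i.-1 \in [:: i - 2; i.-1; i] by rewrite !inE eqxx orbT.
have k3 : i \in [:: i - 2; i.-1; i] by rewrite !inE eqxx !orbT.
have aC : d \in component E [:: i - 2; i.-1; i] d by rewrite inE connect0.
case: (H i d Hi) => [[x0 S]|[[p [q [r [s S]]]]|
  [[x1 [x2 [x3 [x4 [x5 S]]]]]|[u [v [w [x [y [z S]]]]]]]]].
- by have := edge_in_shape S k2 aC e1.
- have i1 := edge_in_shape S k2 aC e1; have i2 := edge_in_shape S k3 aC e2.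
  have [U _ _] := S; split_uniq U.
  by split_edge i1; split_edge i2; congruence.
- have i1 := edge_in_shape S k2 aC e1; have i2 := edge_in_shape S k3 aC e2.
  have i3 := edge_in_shape S k1 aC e3.
  have [U _ _] := S; split_uniq U.
  have I4 : E i x3 x2.
    by apply: (shape_in_edge S) => //; rewrite ?inE /edge_in /= ?eqxx ?orbT.
  have I5 : E i.-1 x1 x2.
    by apply: (shape_in_edge S) => //; rewrite ?inE /edge_in /= ?eqxx ?orbT.
  have I6 : E (i - 2) x1 x2.
    by apply: (shape_in_edge S) => //; rewrite ?inE /edge_in /= ?eqxx ?orbT.
  suff -> : c = x3 by exists x2, x1.
  by split_edge i1; split_edge i2; try congruence; split_edge i3; congruence.
- have i1 := edge_in_shape S k2 aC e1; have i2 := edge_in_shape S k3 aC e2.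
  have [U _ _] := S; split_uniq U.
  by split_edge i1; split_edge i2; congruence.
Qed.

(* Word length and colour bound are separate because letter m+1 is found before
   the edges of colour m are understood. *)
Record coding (m k : nat) (phi : V -> nat -> nat) : Prop := Coding {
  coding_valid : forall v, valid n (phi v) k;
  coding_sigma : forall v h, 0 < h < k -> sigma v h = ascent (phi v) h;
  coding_neighbor : forall v i, 1 < i < m ->
    agree k (phi (neighbor i v)) (dual_word i (phi v));
  coding_inj : forall v s, colors m s -> agree k (phi (acts s v)) (phi v) ->
    acts s v = v }.

(** * Vertices of a component with prescribed words *)

Section Coding.

Variables (m k : nat) (phi : V -> nat -> nat).
Hypotheses (mk : m <= k) (kn : k <= n) (C : coding m k phi).

Lemma coding_acts v s : colors m s -> agree k (phi (acts s v)) (dual_words s (phi v)).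
Proof.
elim: s => [_|i s IH /andP[Hi /IH A]] /=; first exact: agree_refl.
apply: agree_trans (coding_neighbor C _ Hi) _.
by apply: agree_dual => //; nlia.
Qed.

Lemma coding_eq u s t : colors m s -> colors m t ->
  agree k (phi (acts s u)) (phi (acts t u)) -> acts s u = acts t u.
Proof.
move=> Cs Ct A.
have Ct' : colors n t by apply: colors_leq Ct; nlia.
have -> : acts s u = acts (s ++ rev t) (acts t u) by rewrite acts_cat acts_revK.
apply: (coding_inj C); first by rewrite colors_cat Cs colors_rev.
by rewrite acts_cat acts_revK.
Qed.

Lemma coding_last u s j : colors m s -> m < j <= k -> phi (acts s u) j = phi u j.
Proof.
move=> Cs Hj; rewrite (agreeP _ _ _ (coding_acts u Cs)); last nlia.
by apply: dual_words_out Cs _; nlia.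
Qed.

Lemma coding_state u s : colors m s -> state n (phi (acts s u)) m =1 state n (phi u) m.
Proof.
move=> Cs j; have A := coding_acts u Cs.
have [_ <-] := valid_duals (validW mk (coding_valid C u)) Cs.
by apply: eq_state; apply: agree_leq A.
Qed.

(** The first [j] letters can be replaced by any tableau of the same shape, using colours below [j]
    only, so that the later letters stay. *)
Lemma coding_reach u j g : j <= m -> valid n g j -> state n g j =1 state n (phi u) j ->
  exists s, [/\ colors j s, agree j (phi (acts s u)) g &
    forall h, j < h <= k -> phi (acts s u) h = phi u h].
Proof.
move=> jm Vg Sg.
have [|||s Cs As] := @dual_words_connected n (phi u) g j.
- by apply: validW (coding_valid C u); nlia.
- by [].
- by move=> h; rewrite Sg.
have Cs' := colors_leq jm Cs; have A := coding_acts u Cs'.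
exists s; split=> // [|h Hh].
  by apply: agree_trans As; apply: agree_leq A; nlia.
by rewrite (agreeP _ _ _ A) ?(dual_words_out _ Cs) //; nlia.
Qed.

End Coding.

(** * Determination of the next letter *)

(** When the last letters agree, the prefixes of length m have the same shape and are joined by
    colours below m. By axiom 2 these leave sigma_{m+1} unchanged. *)
Lemma sigma_of_last m k phi u s : m < k -> k <= n -> m.+1 < n -> coding m.+1 k phi ->
  colors m.+1 s -> phi (acts s u) m.+1 = phi u m.+1 ->
  sigma (acts s u) m.+1 = sigma u m.+1.
Proof.
move=> mk kn mn C Cs L.
have [||t [Ct At Lt]] := coding_reach (u := u) (g := phi (acts s u)) mk kn C (leqnSn m).
- by apply: validW (coding_valid C _); nlia.
- move=> j; have := eq_flip (phi u m.+1) (coding_state mk kn C u Cs) j.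
  by rewrite !stateS L !flipK.
have Ct' := colors_leq (leqnSn m) Ct.
rewrite -(@coding_eq m.+1 k phi mk kn C u t s) //.
  by rewrite (sigma_acts u Ct) //; nlia.
apply/agreeP => j Hj; have [jm|mj] := leqP j m.
  by rewrite (agreeP _ _ _ At) //; nlia.
rewrite Lt; last nlia.
have [->//|ne] := eqVneq j m.+1.
by rewrite (coding_last mk kn C u Cs) //; nlia.
Qed.

(** Take a vertex [x] of the component whose word ends in q, d, c with q between c and d. Its edge
    of colour m leads to a vertex ending in d. If sigma_{m+1} changed along this edge, axiom 3 would
    make it differ at [x] from sigma_m, which is - because c < d; so it would be + at [x]. *)
Lemma sigma_of_last_monotone m phi u s t : m.+1 < n -> coding m.+1 m.+1 phi ->
  colors m.+1 s -> colors m.+1 t ->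
  phi (acts s u) m.+1 < phi (acts t u) m.+1 ->
  sigma (acts t u) m.+1 -> sigma (acts s u) m.+1.
Proof.
move=> mn C Cs Ct; set c := phi _ _; set d := phi _ _ => cd St.
have mk := leqnn m.+1; have kn := ltnW mn.
have Rc : removable (state n (phi u) m.+1) c.
  rewrite -(eq_removable _ (coding_state mk kn C u Cs)).
  exact: removable_last (coding_valid C _).
have Rd : removable (state n (phi u) m.+1) d.
  rewrite -(eq_removable _ (coding_state mk kn C u Ct)).
  exact: removable_last (coding_valid C _).
have ne : c != d by nlia.
have [l [h [Em Vh Sh [h3 h2 h1]]]] := ex_last_two_removable (coding_valid C u) Rc Rd ne.
case: Em => Em; subst m.
have [r [Cr Ar _]] := coding_reach mk kn C mk Vh Sh.
set x := acts r u in Ar; have Hl : 1 < l.+2 < l.+3 by nlia.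
have Hl' : 1 < l.+2 < n by nlia.
have Ax := agreeP _ _ _ Ar.
have Ay := coding_neighbor C x Hl.
have X1 : phi x l.+1 = h l.+1 by apply: Ax; nlia.
have X2 : phi x l.+2 = d by rewrite Ax ?h2 //; nlia.
have X3 : phi x l.+3 = c by rewrite Ax ?h3 //; nlia.
have sx : sigma x l.+2 = false by rewrite (coding_sigma C) /ascent ?X2 ?X3; nlia.
have sx' : sigma x l.+1.
  by rewrite (coding_sigma C) /ascent ?X1 ?X2; move: h1; rewrite /between; nlia.
have Ly : phi (neighbor l.+2 x) l.+3 = d.
  rewrite (agreeP _ _ _ Ay) ?ltnS ?leqnn // dual_word_high ?transposeE //=.
  by rewrite X1 X2 X3 between_sym.
have ts v w : colors l.+3 v -> colors l.+3 w -> phi (acts v u) l.+3 = phi (acts w u) l.+3 ->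
    sigma (acts v u) l.+3 = sigma (acts w u) l.+3.
  move=> Cv Cw L.
  have -> : acts v u = acts (v ++ rev w) (acts w u).
    by rewrite acts_cat acts_revK //; apply: colors_leq Cw.
  apply: (sigma_of_last mk kn mn C); first by rewrite colors_cat Cv colors_rev.
  by rewrite acts_cat acts_revK //; apply: colors_leq Cw.
have Cr' : colors l.+3 (l.+2 :: r) by rewrite colors_cons Cr Hl.
rewrite (ts s r Cs Cr (esym X3)).
move: St; rewrite (ts t (l.+2 :: r) Ct Cr' (esym Ly)) /= -/x => sy; apply/negPn/negP => nx.
have e : E l.+2 x (neighbor l.+2 x) by apply: edge_neighbor; rewrite //= sx sx'.
have [_ H] := ax3 Hl' e.
by move: (H ltac:(nlia)); rewrite sy sx (negbTE nx) => /(_ isT).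
Qed.

Lemma ex_next_letter m phi : m < n -> coding m m phi ->
  exists A : V -> nat, forall v, addable (state n (phi v) m) (A v) /\
    forall s, colors m s -> A (acts s v) = A v /\
      (0 < m -> sigma (acts s v) m = (phi (acts s v) m < A v)).
Proof.
move=> mn C; have kn := ltnW mn; have mk := leqnn m.
have ex v : exists a, addable (state n (phi v) m) a /\ forall s, colors m s ->
    (0 < m -> sigma (acts s v) m = (phi (acts s v) m < a)).
  (* The corners carrying sign +: by [sigma_of_last], all vertices of the component with letter m
     equal to [r] have the same sign sigma_m. *)
  pose P r := [exists x, [&& connect (Eunion E (iota 2 (m - 2))) v x, phi x m == r
    & sigma x m]].
  have PP r : reflect (exists2 s, colors m s & phi (acts s v) m = r /\ sigma (acts s v) m) (P r).
    apply: (iffP existsP) => [[x /and3P[c /eqP L S]]|[s Cs [L S]]].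
      by have [s Cs Es] := (connectP_acts v x kn).1 c; exists s; rewrite -?Es.
    exists (acts s v); rewrite L S eqxx !andbT.
    by apply: (connectP_acts v _ kn).2; exists s.
  have reach r : removable (state n (phi v) m) r ->
      exists s, [/\ colors m s, phi (acts s v) m = r & 0 < m].
    move=> Rr; have [g [Vg Sg gm m0]] := ex_last_removable (coding_valid C v) Rr.
    have [s [Cs As _]] := coding_reach mk kn C mk Vg Sg.
    by exists s; split=> //; rewrite (agreeP _ _ _ As) // m0 leqnn.
  have [B1 B2] := state_bounds 0 (coding_valid C v).
  have [|||a [Aa Ha]] := @addable_threshold (state n (phi v) m) (n + m) P.
  - by apply: B1.
  - by move=> j; have [_] := state_bounds j (coding_valid C v).
  - move=> c d Rc Rd cd nc; apply/negP => /PP[t Ct [Lt St]].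
    have [s [Cs Ls m0]] := reach c Rc.
    case/negP: nc; apply/PP; exists s => //; split=> //.
    case: m m0 mn C kn mk B1 B2 P PP reach Rc Rd Ct Lt St Cs Ls => // m _ mn C *.
    apply: (sigma_of_last_monotone mn C (t := t)) => //; nlia.
  exists a; split=> // s Cs m0.
  have Rs : removable (state n (phi v) m) (phi (acts s v) m).
    rewrite -(eq_removable _ (coding_state mk kn C v Cs)).
    case: m m0 {mn kn mk P PP reach B1 B2 Aa Ha Cs} C => // m _ C.
    exact: removable_last (coding_valid C _).
  rewrite -Ha //; apply/idP/PP => [S|[t Ct [L S]]]; first by exists s.
  case: m m0 mn C kn mk {P PP reach B1 B2 Aa Ha Rs} Cs Ct L S => // m _ mn C kn mk Cs Ct L S.
  have Es : acts s v = acts (s ++ rev t) (acts t v).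
    by rewrite acts_cat acts_revK //; apply: colors_leq Ct.
  rewrite Es (sigma_of_last mk kn mn C) ?S // -?Es //.
  by rewrite colors_cat Cs colors_rev.
(* [A] is chosen at each vertex separately. It is constant on components because the chosen cells
   are addable to one shape and the signs sigma_m compare them alike with every corner. *)
have [A HA] := fin_all_exists ex; exists A => v; have [Av Sv] := HA v.
split=> // s Cs; split=> [|m0]; last exact: Sv.
have [As Ss] := HA (acts s v).
apply: (@addable_separated (state n (phi v) m)) => //.
  by rewrite -(eq_addable _ (coding_state mk kn C v Cs)).
move=> r Rr; have [g [Vg Sg gm m0]] := ex_last_removable (coding_valid C v) Rr.
have [t [Ct At _]] := coding_reach mk kn C mk Vg Sg.
have Lt : phi (acts t v) m = r by rewrite (agreeP _ _ _ At) // m0 leqnn.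
have Et : acts t v = acts (t ++ rev s) (acts s v).
  by rewrite acts_cat acts_revK //; apply: colors_leq Cs.
rewrite -Lt -Sv // Et Ss //.
by rewrite colors_cat Ct colors_rev.
Qed.

(** * Edges of the top colour m = l+2 *)

Section TopColor.

Variables (l : nat) (psi : V -> nat -> nat).
Hypotheses (ln : l.+3 <= n) (C : coding l.+2 l.+3 psi).

Let Hm : 1 < l.+2 < n. Proof. by rewrite ltnS. Qed.
Let mk : l.+2 <= l.+3. Proof. exact: leqnSn. Qed.

(** The edge commutes with all colours below [l], and axiom 2 preserves the signs below [l] along
    it, so [rigid] applies to the prefixes. *)
Lemma edge_prefix v x : E l.+2 v x -> agree l (psi x) (psi v).
Proof.
move=> e; apply: (@rigid n).
- by apply: validW (coding_valid C _); nlia.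
- by apply: validW (coding_valid C _); nlia.
move=> s h Cs Hh.
have Cs' : colors l.+2 s by apply: colors_leq Cs; nlia.
have e' : E l.+2 (acts s v) (acts s x).
  by apply: edge_acts => //; rewrite !subSS subn0.
have [_ _ H] := ax2 Hm e'.
have S y : ascent (dual_words s (psi y)) h = sigma (acts s y) h.
  rewrite (coding_sigma C); last nlia.
  by rewrite /ascent !(agreeP _ _ _ (coding_acts mk ln C y Cs')) //; nlia.
by rewrite !S H //; nlia.
Qed.

(** Moves the edge to one of the same colour whose ends share any desired prefix of the given shape,
    without touching the three last letters at either end. *)
Lemma edge_retarget v x g : E l.+2 v x -> valid n g l ->
  state n g l =1 state n (psi v) l ->
  exists s, [/\ colors l s, E l.+2 (acts s v) (acts s x),
    agree l (psi (acts s v)) g, agree l (psi (acts s x)) g &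
    forall j, l < j <= l.+3 ->
      psi (acts s v) j = psi v j /\ psi (acts s x) j = psi x j].
Proof.
move=> e Vg Sg.
have le : l <= l.+2 by nlia.
have [s [Cs As Ls]] := coding_reach mk ln C le Vg Sg.
have e' : E l.+2 (acts s v) (acts s x).
  by apply: edge_acts => //; rewrite !subSS subn0.
exists s; split=> //; first exact: agree_trans (edge_prefix e') As.
move=> j Hj; split; first exact: Ls.
have Cs' : colors l.+2 s by apply: colors_leq Cs.
by rewrite (agreeP _ _ _ (coding_acts mk ln C x Cs')) ?(dual_words_out _ Cs) //; nlia.
Qed.

Let a v := psi v l.+1.
Let b v := psi v l.+2.
Let c v := psi v l.+3.

Let sigma_ab v : sigma v l.+1 = (a v < b v).
Proof. by rewrite (coding_sigma C) //; nlia. Qed.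

Let sigma_bc v : sigma v l.+2 = (b v < c v).
Proof. by rewrite (coding_sigma C) //; nlia. Qed.

Let ab_neq v : a v != b v.
Proof. by apply: (valid_neq1 (coding_valid C v)); nlia. Qed.

Let bc_neq v : b v != c v.
Proof. by apply: (valid_neq1 (coding_valid C v)); nlia. Qed.

Let ac_neq v : a v != c v.
Proof. by apply: (valid_neq2 (coding_valid C v) (i := l.+2)); nlia. Qed.

(* If the last letter lies between the two before it, moving to the left of
   them a corner that lies between them turns the edge into a double edge. *)
Lemma edge_last_between v x : E l.+2 v x -> between (a v) (c v) (b v) ->
  agree l.+3 (psi x) (dual_word l.+2 (psi v)) /\
  exists2 s, colors l.+2 s & x = acts s v.
Proof.
move=> e B.
have Vv := coding_valid C v.
have Aa : addable (state n (psi v) l) (a v) by apply: Vv; nlia.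
have Ab : addable (state n (psi v) l) (b v).
  rewrite -(@addable_far _ (a v)); first by apply: (Vv l.+1); nlia.
  by move: B; rewrite /between /far; nlia.
have [p [Bp Rp]] : exists p, between (a v) p (b v) /\ removable (state n (psi v) l) p.
  case: (ltngtP (a v) (b v)) => [ab|ba|eq].
  - have [p [p1 p2 p3]] := removable_between_addable Aa Ab ab.
    by exists p; rewrite /between p1 p2.
  - have [p [p1 p2 p3]] := removable_between_addable Ab Aa ba.
    by exists p; rewrite /between p1 p2 orbT.
  - by move: (ab_neq v); rewrite eq eqxx.
have Vl : valid n (psi v) l by apply: validW Vv; nlia.
have [g [Vg Sg gl l0]] := ex_last_removable Vl Rp.
have [s [Cs e1 Av Ax Ls]] := edge_retarget e Vg Sg.
set v1 := acts s v in e1 Av Ls; set x1 := acts s x in e1 Ax Ls.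
have [a1 _] := Ls l.+1 ltac:(nlia).
have [b1 _] := Ls l.+2 ltac:(nlia).
have [c1 _] := Ls l.+3 ltac:(nlia).
have p1 : psi v1 l = p by rewrite (agreeP _ _ _ Av) // l0 leqnn.
have Hl : 1 < l.+1 < l.+2 by nlia.
have Hl' : 1 < l.+1 < n by nlia.
have Au := coding_neighbor C v1 Hl.
set u := neighbor l.+1 v1 in Au.
have Du : dual_word l.+1 (psi v1) = transpose l.+1 (psi v1).
  by apply: dual_word_high; rewrite /= p1 a1 b1.
rewrite Du in Au.
have Ua : a u = b v by rewrite /a (agreeP _ _ _ Au) ?transposeE ?b1 //; nlia.
have Ub : b u = a v by rewrite /b (agreeP _ _ _ Au) ?transposeE ?a1 //; nlia.
have Uc : c u = c v.
  by rewrite /c (agreeP _ _ _ Au) ?transposeE ?c1 //; nlia.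
have eu : E l.+1 v1 u.
  apply: edge_neighbor => //; rewrite (coding_sigma C); last nlia.
  rewrite sigma_ab /ascent /= p1 /a /b a1 b1.
  by move: Bp; rewrite /between /a /b; nlia.
(* Exchanging the letters a and b leaves c between them, so [u] still has an edge of colour l+2;
   this excludes the path in [two_color]. *)
have Exu : u = x1.
  have [//|[H _]] := two_color (i := l.+2) ltac:(nlia) eu e1.
  case/negP: (H (neighbor l.+2 u)); apply: edge_neighbor => //=.
  rewrite sigma_ab sigma_bc Ua Ub Uc; move: B; rewrite /between; nlia.
have Cs' : colors n s by apply: colors_leq Cs; nlia.
split; last first.
  exists (rev s ++ l.+1 :: s).
    by rewrite colors_cat colors_rev colors_cons Hl (colors_leq _ Cs) // -addn2 leq_addr.
  by rewrite acts_cat /= -/v1 -/u Exu acts_revK.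
have [_ ax] := Ls l.+1 ltac:(nlia).
have [_ bx] := Ls l.+2 ltac:(nlia).
have [_ cx] := Ls l.+3 ltac:(nlia).
rewrite dual_word_low //=.
apply/agreeP => j Hj; have [jl|lj] := leqP j l.
  rewrite (agreeP _ _ _ (edge_prefix e)) ?transposeE //; nlia.
have [->|n1] := eqVneq j l.+1; first by rewrite transposeE -ax -Exu -/(a u) Ua.
have [->|n2] := eqVneq j l.+2; first by rewrite transposeE -bx -Exu -/(b u) Ub.
have -> : j = l.+3 by nlia.
by rewrite -cx -Exu -/(c u) Uc transposeE //; nlia.
Qed.

(** By the signs of axiom 2, [b x] cannot be the median. If [c x] were, the edge taken from [x]
    would exchange only the letters l+1 and l+2, and [c v] would be the median at [v] too. *)
Lemma edge_first_between v x : E l.+2 v x -> between (b v) (a v) (c v) ->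
  between (b x) (a x) (c x).
Proof.
move=> e B; have e' := edge_sym Hm e.
have [s1 s2 _] := ax2 Hm e; move: s1 s2; rewrite /= !sigma_ab !sigma_bc => s1 s2.
have [B'|nB'] := boolP (between (a x) (c x) (b x)).
  have [A _] := edge_last_between e' B'.
  rewrite dual_word_low //= in A; have {}A := agreeP _ _ _ A.
  move: B B'; rewrite {1 2 3}/a {1 2}/b {1 2}/c.
  rewrite (A l.+1) ?(A l.+2) ?(A l.+3) ?transposeE; try nlia.
  by rewrite /between -/(a x) -/(b x) -/(c x); nlia.
move: (ab_neq x) (bc_neq x) (ac_neq x) (ab_neq v) (bc_neq v) (ac_neq v) nB' s1 s2 B.
rewrite /between; nlia.
Qed.

(** Put a corner p as letter [l] at both ends. If p compared differently with [a v] and [a x],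
    sigma_l would change along the edge, and axiom 3 would give both ends an edge of colour l+1. By
    [two_color] this is a double edge, so the words at the two ends differ by d_{l+1}; each of its
    three cases is contradictory. *)
Lemma edge_first_letter v x : E l.+2 v x -> between (b v) (a v) (c v) ->
  a v = a x.
Proof.
move=> e B; have B' := edge_first_between e B.
have [s1 s2 _] := ax2 Hm e; move: s1 s2; rewrite /= !sigma_ab !sigma_bc => s1 s2.
have Vl y : valid n (psi y) l by apply: validW (coding_valid C y); nlia.
apply: (@addable_separated (state n (psi v) l)).
- by apply: (coding_valid C); nlia.
- rewrite (eq_addable _ (eq_state n (agree_sym (edge_prefix e)))).
  by apply: (coding_valid C); nlia.
move=> p Rp.
have [g [Vg Sg gl l0]] := ex_last_removable (Vl v) Rp.
have [s [Cs e1 Av Ax Ls]] := edge_retarget e Vg Sg.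
set v1 := acts s v in e1 Av Ls; set x1 := acts s x in e1 Ax Ls.
have [a1 a2] := Ls l.+1 ltac:(nlia); rewrite -/(a v1) -/(a x1) -/(a v) -/(a x) in a1 a2.
have [b1 b2] := Ls l.+2 ltac:(nlia); rewrite -/(b v1) -/(b x1) -/(b v) -/(b x) in b1 b2.
have [c1 c2] := Ls l.+3 ltac:(nlia); rewrite -/(c v1) -/(c x1) -/(c v) -/(c x) in c1 c2.
have p1 : psi v1 l = p by rewrite (agreeP _ _ _ Av) // l0 leqnn.
have p2 : psi x1 l = p by rewrite (agreeP _ _ _ Ax) // l0 leqnn.
have Sp y : sigma y l = (psi y l < a y) by rewrite (coding_sigma C) //; nlia.
have pv : p != a v.
  rewrite -p1 -a1; apply: (valid_neq1 (coding_valid C v1)); nlia.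
have px : p != a x.
  rewrite -p2 -a2; apply: (valid_neq1 (coding_valid C x1)); nlia.
have [//|ne] := eqVneq (p < a v) (p < a x); exfalso.
have Hl : 1 < l.+1 < l.+2 by nlia.
have Hl' : 1 < l.+1 < n by nlia.
have [H3 _] := ax3 Hm e1.
have {}H3 : sigma v1 l != sigma v1 l.+1.
  by move: H3; rewrite !subSS subn0; apply; [nlia | rewrite !Sp p1 p2 a1 a2].
have H3' : sigma x1 l != sigma x1 l.+1.
  by move: H3; rewrite !Sp !sigma_ab p1 p2 a1 a2 b1 b2; nlia.
have eu := edge_neighbor Hl' H3; have ex := edge_neighbor Hl' H3'.
have [|Eu|[_ H]] := two_color (i := l.+2) _ eu e1; first nlia; last first.
  by move: (H (neighbor l.+1 x1)); rewrite /= ex.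
have Au := coding_neighbor C v1 Hl; rewrite Eu in Au; have {}Au := agreeP _ _ _ Au.
have Ec : c x = c v.
  by rewrite -c1 -c2 {1}/c Au ?dual_word_out //; nlia.
have Eb : b x = dual_word l.+1 (psi v1) l.+2 by rewrite -b2 {1}/b Au //; nlia.
have Ea : a x = dual_word l.+1 (psi v1) l.+1 by rewrite -a2 {1}/a Au //; nlia.
have Hk : 1 < l.+1 < l.+3 by nlia.
have [[_ D]|[_ D]|[_ D]] := dual_wordP (coding_valid C v1) Hk; rewrite D in Ea Eb.
- by move: ne; rewrite Ea -/(a v1) a1 eqxx.
- by move: px; rewrite Ea /= transposeE p1 eqxx.
- rewrite transposeE -/(b v1) b1 in Ea; rewrite transposeE -/(a v1) a1 in Eb.
  by move: B B'; rewrite /between Ea Eb Ec; nlia.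
Qed.

(* With letters q, p, a, b, c such that q separates a from p, colours m-2 and
   m-1 form a double edge at [v] exactly when b separates a from p; by axiom 4
   this is equivalent to colours m-1 and m forming a double edge at the
   (m-2)-neighbour of [x], that is, to c' separating a from p. *)
Lemma edge_second_letter v x : E l.+2 v x -> between (b v) (a v) (c v) ->
  b v = c x.
Proof.
move=> e B; have B' := edge_first_between e B; have Eax := edge_first_letter e B.
have [s1 s2 _] := ax2 Hm e; move: s1 s2; rewrite /= !sigma_ab !sigma_bc => s1 s2.
have Vl y : valid n (psi y) l.+1 by apply: validW (coding_valid C y); nlia.
have Sx : state n (psi x) l.+1 =1 state n (psi v) l.+1.
  by apply/eq_state/agreeS; [exact: edge_prefix | rewrite -/(a x) -Eax].
have Ab : addable (state n (psi v) l.+1) (b v) by apply: (coding_valid C); nlia.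
have Ac : addable (state n (psi v) l.+1) (c x).
  rewrite -(eq_addable _ Sx) -(@addable_far _ (b x)).
    exact: (coding_valid C x (ltnSn l.+2)).
  by move: B'; rewrite /between /far; nlia.
apply: (addable_separated Ab Ac) => p Rp.
have pb : b v != p := addable_neq_removable Ab Rp.
have pc : c x != p := addable_neq_removable Ac Rp.
(* The corner just filled by a needs no further graph argument: the edge reverses the comparison of
   a with b, and a lies between [b x] and [c x], so [b v] and [c x] are on the same side of a. *)
have [Epa|npa] := eqVneq p (a v).
  by move: B B' s1; rewrite Epa -Eax /between; nlia.
have Ra := removable_last (Vl v); rewrite -/(a v) in Ra.
have nap : a v != p by rewrite eq_sym.
have [k [g [El Vg Sg [g3 g2 g1]]]] := ex_last_two_removable (Vl v) Ra Rp nap.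
case: El => El.
have Vg' : valid n g l by apply: validW Vg.
have Sg' : state n g l =1 state n (psi v) l.
  move=> j; have := eq_flip (a v) Sg j; rewrite !stateS -/(a v).
  by rewrite [g l.+1](_ : _ = a v) ?El // !flipK.
have [s [Cs e1 Av Ax Ls]] := edge_retarget e Vg' Sg'.
set v1 := acts s v in e1 Av Ls; set x1 := acts s x in e1 Ax Ls.
have [a1 a2] := Ls l.+1 ltac:(nlia); rewrite -/(a v1) -/(a x1) -/(a v) -/(a x) in a1 a2.
have [b1 b2] := Ls l.+2 ltac:(nlia); rewrite -/(b v1) -/(b x1) -/(b v) -/(b x) in b1 b2.
have [c1 c2] := Ls l.+3 ltac:(nlia); rewrite -/(c v1) -/(c x1) -/(c v) -/(c x) in c1 c2.
have p1 : psi v1 l = p by rewrite (agreeP _ _ _ Av) ?El ?g2 //; nlia.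
have p2 : psi x1 l = p by rewrite (agreeP _ _ _ Ax) ?El ?g2 //; nlia.
have q1 : psi v1 l.-1 = g k.+1 by rewrite (agreeP _ _ _ Av) ?El //; nlia.
have q2 : psi x1 l.-1 = g k.+1 by rewrite (agreeP _ _ _ Ax) ?El //; nlia.
have l0 : 1 < l by rewrite El.
have Hi : 1 < l < l.+2 by rewrite l0 ltnW.
have Hi' : 1 < l < n by nlia.
have Hj : 1 < l.+1 < l.+2 by nlia.
have Hj' : 1 < l.+1 < n by nlia.
have Sp y : sigma y l = (psi y l < a y) by rewrite (coding_sigma C) //; nlia.
have Sq y : sigma y l.-1 = (psi y l.-1 < psi y l).
  by rewrite (coding_sigma C) /ascent ?prednK //; nlia.
(* With q, p, a at places l-1, l, l+1, the edge of colour [l] exchanges p and a. *)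
have lowE y : psi y l = p -> a y = a v -> psi y l.-1 = g k.+1 ->
    E l y (neighbor l y) /\ agree l.+3 (psi (neighbor l y)) (transpose l (psi y)).
  move=> yp ya yq; split.
    apply: edge_neighbor => //; rewrite Sp Sq yp ya yq.
    by move: g1; rewrite /between; nlia.
  have A := coding_neighbor C y Hi; rewrite dual_word_high // in A.
  by rewrite -/(a y) yp ya yq between_sym.
have [ev Av2] := lowE v1 p1 a1 q1; have [ex Ax2] := lowE x1 p2 (etrans a2 (esym Eax)) q2.
set d := neighbor l x1 in ex Ax2.
have {}Ax2 := agreeP _ _ _ Ax2; have {}Av2 := agreeP _ _ _ Av2.
have Ad : a d = p by rewrite /a Ax2 ?transposeE ?p2 //; nlia.
have Bd : b d = b x by rewrite /b Ax2 ?transposeE //; nlia.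
have Cd : c d = c x by rewrite /c Ax2 ?transposeE //; nlia.
have Pd : psi d l = a v by rewrite Ax2 ?transposeE -?/(a x1) ?a2 //; nlia.
(* The last four letters of [d] are a, p, [b x], [c x]; if a lies between p and [b x], colour l+1
   exchanges these two. *)
have topE : between p (a v) (b x) -> let y := neighbor l.+1 d in
    [/\ E l.+1 d y, a y = b x, b y = p & c y = c x].
  move=> Bp y.
  have A := coding_neighbor C d Hj; rewrite dual_word_high in A; last first.
    by rewrite /= Pd -/(a d) -/(b d) Ad Bd.
  have {}A := agreeP _ _ _ A; split.
  - by apply: edge_neighbor => //; rewrite /= sigma_ab Sp Pd Ad Bd; move: Bp; rewrite /between; nlia.
  - by rewrite /a A ?transposeE -/(b d) ?Bd //; nlia.
  - by rewrite /b A ?transposeE -/(a d) ?Ad //; nlia.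
  - by rewrite /c A ?transposeE -/(c d) ?Cd //; nlia.
have i2 : l.+2 - 2 = l by rewrite !subSS subn0.
(* From the double edge at [v1] to the one at [d]. *)
have fwd : between (a v) (b v) p -> between (a v) (c x) p.
  move=> Bp.
  have A := coding_neighbor C v1 Hj; rewrite dual_word_low in A; last first.
    by rewrite /= -/(b v1) -/(a v1) p1 a1 b1 between_sym.
  have Edbl : neighbor l v1 = neighbor l.+1 v1.
    have := @coding_eq _ _ _ mk ln C v1 [:: l] [:: l.+1]; apply.
    - by rewrite /colors /= Hi.
    - by rewrite /colors /= Hj.
    - rewrite /=; apply: agree_trans (agree_sym A).
      by apply/agreeP.
  have ev' : E l.+1 v1 (neighbor l v1).
    rewrite Edbl; apply: edge_neighbor => //; rewrite /= sigma_ab Sp p1 a1 b1.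
    by move: Bp; rewrite /between; nlia.
  have [||||d' [y [f1 f2 f3]]] := @three_color l.+2 (neighbor l v1) v1 x1.
  - by nlia.
  - by rewrite i2; apply: edge_sym.
  - by apply: edge_sym.
  - by [].
  rewrite i2 in f1; have Ed : d' = d by rewrite -(neighborE Hi' f1).
  subst d'.
  have Bpx : between p (a v) (b x) by move: Bp B B' s1; rewrite -Eax /between; nlia.
  have [_ ya yb yc] := topE Bpx.
  rewrite /= in f2; rewrite (neighborE Hj' f2) in ya yb yc.
  have [_ f4 _] := ax2 Hm f3; rewrite !sigma_bc Bd Cd yb yc in f4.
  by move: f4 Bpx B'; rewrite -Eax /between; nlia.
(* From the double edge at [d] back to the one at [v1]. *)
have bwd : between (a v) (c x) p -> between (a v) (b v) p.
  move=> Bp.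
  have Bpx : between p (a v) (b x) by move: Bp B'; rewrite -Eax /between; nlia.
  have [f1 ya yb yc] := topE Bpx; set y := neighbor l.+1 d in f1 ya yb yc.
  have f2 : E l.+2 d (neighbor l.+2 d).
    apply: edge_neighbor => //=; rewrite sigma_ab sigma_bc Ad Bd Cd.
    by move: Bp Bpx; rewrite /between; nlia.
  have Ey : y = neighbor l.+2 d.
    have [//|[H _]] := @two_color l.+2 y d (neighbor l.+2 d) ltac:(nlia) f1 f2.
    case/negP: (H (neighbor l.+2 y)); apply: edge_neighbor => //=.
    by rewrite sigma_ab sigma_bc ya yb yc; move: Bp Bpx; rewrite /between; nlia.
  have [||||b0 [a0 [h1 h2 h3]]] := @three_color_rev l.+2 x1 d y.
  - by nlia.
  - by [].
  - by rewrite Ey.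
  - by rewrite i2; apply: edge_sym.
  rewrite i2 in h2; rewrite /= in h3.
  have E0 : b0 = v1 by rewrite -(neighborE Hm h1); apply: neighborE => //; apply: edge_sym.
  subst b0.
  have En : neighbor l v1 = neighbor l.+1 v1.
    by rewrite (neighborE Hi' (edge_sym Hi' h2)) (neighborE Hj' (edge_sym Hj' h3)).
  (* Otherwise p lies between a and b, so d_{l+1} keeps p at place [l] while d_l puts a there,
     against the double edge. *)
  apply/negPn/negP => nB.
  have A := coding_neighbor C v1 Hj; rewrite dual_word_high in A; last first.
    rewrite /= -/(b v1) -/(a v1) p1 a1 b1.
    by move: Bp Bpx B B' s1 nB; rewrite -Eax /between; nlia.
  have := Av2 l ltac:(nlia); rewrite En (agreeP _ _ _ A); last nlia.
  rewrite !transposeE -/(a v1) ?p1 ?a1; [|nlia|nlia].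
  by move/eqP; rewrite eq_sym (negbTE nap).
(* [b v] and [c x] lie on the same side of a; since both or neither lie between a and p, they are on
   the same side of p. *)
by move: fwd bwd B B' s1; rewrite -Eax /between; nlia.
Qed.

Lemma coding_neighbor_top v : agree l.+3 (psi (neighbor l.+2 v)) (dual_word l.+2 (psi v)).
Proof.
have Hk : 1 < l.+2 < l.+3 by nlia.
have [e|[-> eq]] := edge_or_fixed v Hm; last first.
  rewrite dual_word_fix; first exact: agree_refl.
  rewrite /= -/(a v) -/(b v) -/(c v); move: eq; rewrite /= sigma_ab sigma_bc.
  by move: (ab_neq v) (bc_neq v); rewrite /between; nlia.
set x := neighbor _ v in e *.
have [[B _]|[B _]|[B D]] := dual_wordP (coding_valid C v) Hk.
- move: (edge_sigma Hm e) B; rewrite /= sigma_ab sigma_bc /between -/(a v) -/(b v) -/(c v).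
  by nlia.
- by have [] := edge_last_between e B.
have B' := edge_first_between e B.
have E1 := edge_first_letter e B; have E2 := edge_second_letter e B.
(* Taken from the other end, the same argument gives [b x = c v]. *)
have E3 := edge_second_letter (edge_sym Hm e) B'.
rewrite D; apply/agreeP => j Hj; have [jl|lj] := leqP j l.
  by rewrite (agreeP _ _ _ (edge_prefix e)) ?transposeE //; nlia.
have [->|n1] := eqVneq j l.+1.
  by rewrite transposeE; [exact: esym E1 | nlia | nlia].
have [->|n2] := eqVneq j l.+2; first by rewrite transposeE; exact: E3.
have -> : j = l.+3 by nlia.
by rewrite transposeE; exact: esym E2.
Qed.

(** Axiom 6 gives a path with at most one edge of colour l+2. Lower colours fix the last letter,
    which is the same at both ends of the path, so that edge does not change it either. It is then
    of the kind where c is the median, and lower colours can replace it. *)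
Lemma coding_inj_top v s : colors l.+3 s -> agree l.+3 (psi (acts s v)) (psi v) ->
  acts s v = v.
Proof.
move=> Cs A.
have same t : colors l.+2 t -> acts s v = acts t v -> acts s v = v.
  by move=> Ct Et; rewrite Et in A *; apply: (coding_inj C).
have con := (connectP_acts v (acts s v) ln).2 (ex_intro2 _ _ s Cs erefl).
rewrite !subSS subn0 in con.
have ln' := ltnW ln.
have [H|[a0 [b0 [H1 e H2]]]] := ax6 Hm con.
  by have [t Ct Et] := (connectP_acts v (acts s v) ln').1 H; apply: (same t).
have [t1 C1 E1] := (connectP_acts v a0 ln').1 H1.
have [t2 C2 E2] := (connectP_acts b0 (acts s v) ln').1 H2.
have top := ltnSn l.+2.
have Lab : c a0 = c b0.
  rewrite /c E1 (coding_last mk ln C v C1) ?top ?leqnn //.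
  rewrite -(coding_last mk ln C b0 C2) ?top ?leqnn // -E2.
  by rewrite (agreeP _ _ _ A).
have Hk : 1 < l.+2 < l.+3 by nlia.
have B : between (a a0) (c a0) (b a0).
  have At := coding_neighbor_top a0; rewrite (neighborE Hm e) in At.
  have [[B _]|[B _]|[B D]] := dual_wordP (coding_valid C a0) Hk.
  - move: (edge_sigma Hm e) B; rewrite /= sigma_ab sigma_bc /between -/(a a0) -/(b a0) -/(c a0).
    by nlia.
  - exact: B.
  move: Lab; rewrite D in At; rewrite {2}/c (agreeP _ _ _ At) ?leqnn // transposeE.
  by move/eqP; rewrite eq_sym (negbTE (bc_neq a0)).
have [_ [t C3 E3]] := edge_last_between e B.
apply: (same (t2 ++ t ++ t1)); first by rewrite !colors_cat C1 C2 C3.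
by rewrite !acts_cat -E1 -E3 -E2.
Qed.

End TopColor.

Lemma coding_next m phi : m < n -> coding m m phi -> exists psi, coding m m.+1 psi.
Proof.
move=> mn C; have [A HA] := ex_next_letter mn C.
exists (fun v => snoc (phi v) m (A v)).
have As v := snoc_agree (phi v) m (A v).
split.
- by move=> v; have [Aa _] := HA v; apply: valid_snoc => //; apply: (coding_valid C).
- move=> v h /andP[h0]; rewrite ltnS leq_eqVlt => /orP[/eqP Eh|hm].
    subst h; have [_ /(_ [::] isT)[_ /(_ h0)]] := HA v.
    by rewrite /= /ascent snoc_last (agreeP _ _ _ (As v)) // h0 leqnn.
  by rewrite (coding_sigma C) /ascent ?(agreeP _ _ _ (As v)) //; nlia.
- move=> v i Hi; apply: agreeS.
    apply: agree_trans (As _) _; apply: agree_trans (coding_neighbor C v Hi) _.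
    by apply: agree_dual => //; apply: agree_sym.
  rewrite snoc_last dual_word_out ?snoc_last; try nlia.
  have Ci : colors m [:: i] by rewrite /colors /= Hi.
  by have [_ /(_ _ Ci)[-> _]] := HA v.
- move=> v s Cs Ag; apply: (coding_inj C) => //.
  apply: agree_trans (agree_sym (As _)) _; apply: agree_trans (As v).
  exact: agree_leq Ag.
Qed.

Lemma ex_coding m : m <= n -> exists phi, coding m m phi.
Proof.
elim: m => [|m IH] mn.
  exists (fun _ _ => 0); split=> //; first by move=> v h; rewrite ltn0 andbF.
  by move=> v [|i s] //=; rewrite /colors /= ltn0 andbF.
have [phi Cphi] := IH (ltnW mn).
have [psi Cpsi] := coding_next mn Cphi.
(* Words of length one or two involve no colour; for longer ones the only new colour is l+2. *)
case: m mn Cpsi {IH Cphi} => [|[|l]] mn Cpsi; exists psi.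
- split; [exact: coding_valid Cpsi | exact: coding_sigma Cpsi | by move=> v i; nlia |].
  by move=> v [|i s] //; rewrite colors_cons; nlia.
- split; [exact: coding_valid Cpsi | exact: coding_sigma Cpsi | by move=> v i; nlia |].
  by move=> v [|i s] //; rewrite colors_cons; nlia.
split.
- exact: coding_valid Cpsi.
- exact: coding_sigma Cpsi.
- move=> v i Hi; have [->|ne] := eqVneq i l.+2; first exact: coding_neighbor_top.
  by apply: (coding_neighbor Cpsi); nlia.
- by move=> v s; apply: coding_inj_top.
Qed.

End DualEquivalenceGraph.

(** * Tableaux and content words *)

Definition row_length (r : nat -> nat) (j y : nat) : nat :=
  count (fun i => r i == y) (iota 1 j).

(** The ballot condition on the word of rows, where [r j] is the row of the entry [j] counted from
    0: at each step the row lengths form a partition. *)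
Definition lattice (r : nat -> nat) (n : nat) : Prop :=
  forall j y, j < n -> r j.+1 = y.+1 -> row_length r j y.+1 < row_length r j y.

Definition row_content (N : nat) (r : nat -> nat) (j : nat) : nat :=
  N + row_length r j.-1 (r j) - r j.

(* The boundary of the shape with row lengths [L], one [true] per row (empty
   rows included); row [y] sits at N + L y - y, where its next cell would go. *)
Definition maya (N : nat) (L : nat -> nat) (k : nat) : bool :=
  has (fun y => k == N + L y - y) (iota 0 N.+1).

Lemma row_lengthS r j y : row_length r j.+1 y = row_length r j y + (r j.+1 == y).
Proof. by rewrite /row_length -{1}[j.+1]addn1 iotaD count_cat /= addn0 add1n. Qed.

Lemma eq_row_length r r' j : (forall i, 0 < i <= j -> r i = r' i) ->
  row_length r j =1 row_length r' j.
Proof.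
by move=> H y; apply: eq_in_count => i; rewrite mem_iota => Hi; rewrite H //; lia.
Qed.

Lemma lattice_antitone r n j y z : lattice r n -> j <= n -> y <= z ->
  row_length r j z <= row_length r j y.
Proof.
move=> Lr jn; elim: z => [|z IH]; first by rewrite leqn0 => /eqP->.
rewrite leq_eqVlt => /orP[/eqP->//|yz]; apply: leq_trans (IH yz).
elim: j jn {IH yz} => // j IH jn; rewrite !row_lengthS.
have {}IH := IH (ltnW jn).
have [E|ne] := eqVneq (r j.+1) z.+1; last by lia.
by have := Lr j z jn E; lia.
Qed.

(** Keeps the truncated subtraction in [row_content] exact: a row receives an entry only after the
    row below it has one. *)
Lemma lattice_row_lt r n j : lattice r n -> j < n -> r j.+1 <= j.
Proof.
move=> Lr; elim/ltn_ind: j => j IH jn.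
case E: (r j.+1) => [|y] //.
have H := Lr j y jn E; have [jy|//] := leqP j y.
have /hasP[i] : has (fun i => r i == y) (iota 1 j) by rewrite has_count; apply: leq_ltn_trans H.
rewrite mem_iota; case: i => // i Hi /eqP Ei.
by have := IH i ltac:(lia) ltac:(lia); lia.
Qed.

Lemma row_length_0 r n j y : lattice r n -> j <= n -> j <= y -> row_length r j y = 0.
Proof.
move=> Lr jn jy; apply/eqP; rewrite -leqn0 leqNgt -has_count; apply/hasPn => i.
rewrite mem_iota; case: i => // i Hi.
by have := lattice_row_lt (j := i) Lr ltac:(lia); lia.
Qed.

Lemma lattice_position_lt N r n j y z : lattice r n -> j <= n -> y < z -> z <= N ->
  N + row_length r j z - z < N + row_length r j y - y.
Proof. by move=> Lr jn yz zN; have := lattice_antitone Lr jn (ltnW yz); lia. Qed.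

Lemma mayaP N L k : reflect (exists2 y, y <= N & k = N + L y - y) (maya N L k).
Proof.
apply: (iffP hasP) => [[y]|[y yN ->]].
  by rewrite mem_iota => Hy /eqP->; exists y => //; lia.
by exists y => //; rewrite mem_iota.
Qed.

Section Lattice.

Variables (N n : nat) (r : nat -> nat).
Hypotheses (nN : n <= N) (Lr : lattice r n).

(** The next place could only be occupied by the row just below, but the ballot condition makes that
    row strictly longer and pushes it further right. *)
Lemma addable_maya j : j < n ->
  addable (maya N (row_length r j)) (row_content N r j.+1).
Proof.
move=> jn; have rj := lattice_row_lt Lr jn.
apply/andP; split; first by apply/mayaP; exists (r j.+1); rewrite /row_content //; lia.
apply/negP => /mayaP[y yN]; rewrite /row_content /= => Ey.
case: (ltngtP y (r j.+1)) => [lt|gt|eq].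
- case E: (r j.+1) lt Ey => [|z] // lt Ey.
  have L1 := Lr jn E.
  have [eq|ne] := eqVneq y z; first by subst y; lia.
  have := @lattice_position_lt N r n j y z Lr (ltnW jn) ltac:(lia) ltac:(lia); lia.
- have := @lattice_position_lt N r n j _ y Lr (ltnW jn) gt yN; lia.
- by rewrite eq in Ey; lia.
Qed.

Lemma mayaS j : j < n ->
  maya N (row_length r j.+1) =1 flip (maya N (row_length r j)) (row_content N r j.+1).
Proof.
move=> jn k; have rj := lattice_row_lt Lr jn.
have /andP[] := addable_maya jn; set c := row_content N r j.+1 => c1 c2.
have cE : c = N + row_length r j (r j.+1) - r j.+1 by [].
rewrite /flip /toggle.
have [Ek|nk] := eqVneq k c.
  subst k; rewrite c1; have -> : (c == c.+1) = false by lia.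
  apply/negbTE/negP => /mayaP[y yN]; rewrite row_lengthS => Ey.
  have [ey|ny] := eqVneq (r j.+1) y; first by subst y; rewrite eqxx in Ey; lia.
  rewrite (negbTE ny) addn0 in Ey.
  case: (ltngtP y (r j.+1)) => [lt|gt|eq]; last by rewrite eq eqxx in ny.
    have := @lattice_position_lt N r n j _ _ Lr (ltnW jn) lt ltac:(lia); lia.
  have := @lattice_position_lt N r n j _ y Lr (ltnW jn) gt yN; lia.
have [Ek'|nk'] := eqVneq k c.+1.
  subst k; rewrite (negbTE c2); apply/mayaP; exists (r j.+1); first lia.
  by rewrite row_lengthS eqxx; lia.
rewrite !addbF; apply/mayaP/mayaP => -[y yN Ey]; exists y => //; move: Ey;
  rewrite row_lengthS; have [ey|ny] := eqVneq (r j.+1) y; rewrite ?addn0 //;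
  by subst y; lia.
Qed.

Lemma state_row_content j : j <= n ->
  state N (row_content N r) j =1 maya N (row_length r j).
Proof.
elim: j => [|j IH] jn k.
  apply/idP/mayaP => [kN|[y yN ->]] /=; last by rewrite /row_length /=; lia.
  by exists (N - k); rewrite /row_length /=; move: kN => /=; lia.
by rewrite mayaS // stateS; apply: eq_flip; apply: IH; apply: ltnW.
Qed.

Lemma valid_row_content : valid N (row_content N r) n.
Proof.
by move=> j jn; rewrite (eq_addable _ (state_row_content (ltnW jn))); apply: addable_maya.
Qed.

End Lattice.

(** An addable place is [true], hence marks the end of some row [y], which receives the new
    entry. *)
Lemma ex_lattice N n f : n <= N -> valid N f n ->
  exists2 r, lattice r n & agree n (row_content N r) f.
Proof.
elim: n => [|n IH] nN V; first by exists (fun=> 0).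
have [r Lr Ar] := IH (ltnW nN) (validW (leqnSn n) V).
have := V n (ltnSn n); rewrite -(eq_addable _ (eq_state N Ar)).
rewrite (eq_addable _ (state_row_content (ltnW nN) Lr (leqnn n))).
case/andP=> /mayaP[y yN Ey] c2.
pose r' := snoc r n y.
have rE j : j <= n -> row_length r' j =1 row_length r j.
  by move=> jn; apply: eq_row_length => i Hi; rewrite /r' /snoc ifF //; lia.
exists r'.
  move=> j z; rewrite ltnS leq_eqVlt => /orP[/eqP->|jn]; last first.
    by rewrite !rE ?[r' _]ifF; try lia; apply: Lr.
  rewrite /r' snoc_last -/r' !rE // => Ez; subst y.
  (* If the row below had the same length it would occupy the place after the addable one, which is
     empty. *)
  rewrite ltnNge; apply/negP => le.
  have eq : row_length r n z = row_length r n z.+1.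
    by apply/eqP; rewrite eqn_leq le (lattice_antitone Lr).
  by case/negP: c2; apply/mayaP; exists z; [lia | rewrite eq Ey; lia].
apply: agreeS.
  apply: agree_trans Ar; apply/agreeP => j Hj.
  rewrite /row_content rE; last lia.
  by have -> : r' j = r j by rewrite /r' /snoc ifF //; lia.
by rewrite Ey /row_content /r' snoc_last -/r' /= rE.
Qed.

Lemma row_content_inj N n r r' : n <= N -> lattice r n -> lattice r' n ->
  agree n (row_content N r) (row_content N r') ->
  forall j, 0 < j <= n -> r j = r' j.
Proof.
move=> nN Lr Lr' /agreeP A; elim/ltn_ind => -[//|j] IH Hj.
have LE : row_length r j =1 row_length r' j.
  by apply: eq_row_length => i Hi; apply: IH; lia.
have jn : j < n by lia.
have := A j.+1 Hj; rewrite /row_content /= -LE => Ej.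
have b1 := lattice_row_lt Lr jn; have b2 := lattice_row_lt Lr' jn.
case: (ltngtP (r j.+1) (r' j.+1)) => // lt.
  have := @lattice_position_lt N r n j _ _ Lr (ltnW jn) lt ltac:(lia); lia.
have := @lattice_position_lt N r n j _ _ Lr (ltnW jn) lt ltac:(lia); lia.
Qed.

(** * Standard tableaux and their words of rows *)

Definition row_of (T : seq (seq nat)) (j : nat) : nat := find (fun s => j \in s) T.

Definition col_of (T : seq (seq nat)) (j : nat) : nat :=
  index j (nth [::] T (row_of T j)).

Definition content_word (N : nat) (T : seq (seq nat)) (j : nat) : nat :=
  N + col_of T j - row_of T j.

Definition tableau_of (r : nat -> nat) (n h : nat) : seq (seq nat) :=
  [seq [seq j <- iota 1 n | r j == y] | y <- iota 0 h].

Lemma nth_tableau_of r n h y : y < h ->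
  nth [::] (tableau_of r n h) y = [seq j <- iota 1 n | r j == y].
Proof. by move=> yh; rewrite (nth_map 0) ?size_iota // nth_iota. Qed.

Lemma iota_split n j : 0 < j <= n ->
  iota 1 n = iota 1 j.-1 ++ j :: iota j.+1 (n - j).
Proof.
move=> Hj; have {1}-> : n = j.-1 + (n - j).+1 by lia.
by rewrite iotaD /= add1n prednK //; lia.
Qed.

Lemma index_fiber r n j : 0 < j <= n ->
  index j [seq i <- iota 1 n | r i == r j] = row_length r j.-1 (r j).
Proof.
move=> Hj; rewrite (iota_split Hj) filter_cat index_cat mem_filter mem_iota.
rewrite ifF; last by apply/negbTE; rewrite negb_and; apply/orP; right; lia.
by rewrite /= eqxx /= eqxx addn0 size_filter.
Qed.

Lemma nth_fiber_lt r n j y x : 0 < j <= n.+1 -> x < row_length r j.-1 y ->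
  nth 0 [seq i <- iota 1 n | r i == y] x < j.
Proof.
move=> Hj Hx.
have -> : iota 1 n = iota 1 j.-1 ++ iota j (n - j.-1).
  have {1}-> : n = j.-1 + (n - j.-1) by lia.
  by rewrite iotaD add1n prednK //; lia.
have Hx' : x < size [seq i <- iota 1 j.-1 | r i == y] by rewrite size_filter.
rewrite filter_cat nth_cat Hx'.
set s := [seq i <- iota 1 j.-1 | r i == y] in Hx' *.
have : nth 0 s x \in s by apply: mem_nth.
by rewrite mem_filter mem_iota; lia.
Qed.

Lemma nth_fiber_ge r n j y x : 0 < j <= n.+1 -> row_length r j.-1 y <= x ->
  x < row_length r n y -> j <= nth 0 [seq i <- iota 1 n | r i == y] x.
Proof.
move=> Hj Hx; rewrite /row_length -size_filter.
have -> : iota 1 n = iota 1 j.-1 ++ iota j (n - j.-1).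
  have {1}-> : n = j.-1 + (n - j.-1) by lia.
  by rewrite iotaD add1n prednK //; lia.
have Hx' : size [seq i <- iota 1 j.-1 | r i == y] <= x by rewrite size_filter.
rewrite filter_cat size_cat nth_cat (leq_gtF Hx') => Hx''.
have Hx3 : x - size [seq i <- iota 1 j.-1 | r i == y] <
   size [seq i <- iota j (n - j.-1) | r i == y] by lia.
set s := [seq i <- iota j (n - j.-1) | r i == y] in Hx3 *.
have : nth 0 s (x - size [seq i <- iota 1 j.-1 | r i == y]) \in s by apply: mem_nth.
by rewrite mem_filter mem_iota; lia.
Qed.

Lemma partition_antitone n lam y : is_partition n lam -> nth 0 lam y.+1 <= nth 0 lam y.
Proof.
case/and3P=> /(sortedP 0) S _ _; have [lt|ge] := ltnP y.+1 (size lam); first exact: S.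
by rewrite [nth 0 lam y.+1]nth_default.
Qed.

Lemma partition_size n lam : is_partition n lam -> size lam <= n.
Proof.
case/and3P=> _ P /eqP <-; elim: lam P => //= x lam IH /andP[x0 /IH]; lia.
Qed.

Section StandardTableau.

Variables (n : nat) (lam : seq nat) (T : seq (seq nat)).
Hypotheses (Plam : is_partition n lam) (ST : is_SYT lam T).

Lemma SYT_size : size T = size lam.
Proof. by have [<- _ _ _] := ST; rewrite size_map. Qed.

Lemma SYT_row_size y : size (nth [::] T y) = nth 0 lam y.
Proof.
have [<- _ _ _] := ST; have [lt|ge] := ltnP y (size T); first by rewrite (nth_map [::]).
by rewrite !nth_default ?size_map.
Qed.

Lemma SYT_perm : perm_eq (flatten T) (iota 1 n).
Proof. by have [_ P _ _] := ST; case/and3P: Plam => _ _ /eqP <-. Qed.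

Lemma SYT_mem j : (j \in flatten T) = (0 < j <= n).
Proof. by rewrite (perm_mem SYT_perm) mem_iota add1n ltnS. Qed.

Lemma uniq_flatten_find (S : seq (seq nat)) y j : uniq (flatten S) ->
  j \in nth [::] S y -> find (fun s => j \in s) S = y.
Proof.
elim: S y => [|s S IH] y /=; first by rewrite nth_nil.
rewrite cat_uniq => /and3P[_ /hasPn D U].
case: y => [|y] /= Hj; first by rewrite Hj.
rewrite ifF; first by rewrite (IH y).
apply/negbTE/D/flattenP; exists (nth [::] S y) => //.
by apply: mem_nth; rewrite ltnNge; apply/negP => le; rewrite nth_default in Hj.
Qed.

Lemma SYT_row_of y j : j \in nth [::] T y -> row_of T j = y.
Proof.
by apply: uniq_flatten_find; rewrite (perm_uniq SYT_perm) iota_uniq.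
Qed.

Lemma SYT_mem_row y j : (j \in nth [::] T y) = (0 < j <= n) && (row_of T j == y).
Proof.
apply/idP/andP => [Hj|[Hj /eqP <-]].
  split; last by apply/eqP/SYT_row_of.
  rewrite -SYT_mem; apply/flattenP; exists (nth [::] T y) => //.
  by apply: mem_nth; rewrite ltnNge; apply/negP => le; rewrite nth_default in Hj.
rewrite -SYT_mem in Hj; case/flattenP: Hj => s sT js.
by apply: (nth_find [::] (a := fun s => j \in s)); apply/hasP; exists s.
Qed.

Lemma SYT_row y : nth [::] T y = [seq j <- iota 1 n | row_of T j == y].
Proof.
apply: (irr_sorted_eq ltn_trans ltnn).
- have [_ _ /allP S _] := ST; have [lt|ge] := ltnP y (size T); last by rewrite nth_default.
  by apply: S; apply: mem_nth.
- by apply: sorted_filter; [exact: ltn_trans | exact: iota_ltn_sorted].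
by move=> j; rewrite SYT_mem_row mem_filter mem_iota add1n ltnS andbC.
Qed.

Lemma SYT_row_length y : row_length (row_of T) n y = nth 0 lam y.
Proof. by rewrite -SYT_row_size SYT_row size_filter. Qed.

Lemma SYT_row_lt j : 0 < j <= n -> row_of T j < size T.
Proof.
rewrite -SYT_mem => /flattenP[s sT js]; rewrite /row_of -has_find.
by apply/hasP; exists s.
Qed.

(** The entry just below j+1 is smaller, so the row below already reaches past the column of j+1
    among the entries up to j. *)
Lemma SYT_lattice : lattice (row_of T) n.
Proof.
move=> j y jn Ej; have Hj : 0 < j.+1 <= n by [].
have [_ _ _ Col] := ST.
have E1 : index j.+1 (nth [::] T y.+1) = row_length (row_of T) j y.+1.
  by have := index_fiber (row_of T) Hj; rewrite Ej -SYT_row.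
have Mj : j.+1 \in nth [::] T y.+1 by rewrite SYT_mem_row Hj Ej eqxx.
have lt1 : row_length (row_of T) j y.+1 < nth 0 lam y.+1.
  by rewrite -E1 -SYT_row_size index_mem.
have := Col y _ lt1; rewrite -{2}E1 nth_index // SYT_row => lt2.
rewrite ltnNge; apply/negP => le.
have := @nth_fiber_ge (row_of T) n j.+1 y _ ltac:(lia) le.
rewrite SYT_row_length (leq_trans lt1 (partition_antitone y Plam)) => /(_ isT).
by lia.
Qed.

Lemma SYT_col_of j : 0 < j <= n -> col_of T j = row_length (row_of T) j.-1 (row_of T j).
Proof. by move=> Hj; rewrite /col_of SYT_row index_fiber. Qed.

Lemma content_word_lattice N : agree n (content_word N T) (row_content N (row_of T)).
Proof. by apply/agreeP => j Hj; rewrite /content_word SYT_col_of. Qed.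

Lemma SYT_tableau_of : T = tableau_of (row_of T) n (size T).
Proof.
apply: (@eq_from_nth _ [::]); first by rewrite size_map size_iota.
by move=> y yT; rewrite nth_tableau_of // SYT_row.
Qed.

Lemma SYT_valid N : n <= N -> valid N (content_word N T) n.
Proof.
move=> nN; apply: eq_valid (agree_sym (content_word_lattice N)) _.
exact: valid_row_content nN SYT_lattice.
Qed.

Lemma SYT_state N : n <= N -> state N (content_word N T) n =1 maya N (fun y => nth 0 lam y).
Proof.
move=> nN k; rewrite (eq_state N (content_word_lattice N)).
rewrite (state_row_content nN SYT_lattice (leqnn n)).
by apply: eq_has => y; rewrite SYT_row_length.
Qed.

Lemma SYT_row_nonempty y : y < size T -> has (fun j => row_of T j == y) (iota 1 n).
Proof.
move=> yT; rewrite has_count -/(row_length _ _ _) SYT_row_length.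
by case/and3P: Plam => _ /allP P _; apply: P; apply: mem_nth; rewrite -SYT_size.
Qed.

End StandardTableau.

(** The shapes may differ a priori, as uniqueness of the partition requires. Rows are nonempty, so
    the rows of the entries also determine the number of rows. *)
Lemma content_word_inj N n lam mu T S : n <= N ->
  is_partition n lam -> is_partition n mu -> is_SYT lam T -> is_SYT mu S ->
  agree n (content_word N T) (content_word N S) -> T = S.
Proof.
move=> nN Pl Pm HT HS A.
have R : forall j, 0 < j <= n -> row_of T j = row_of S j.
  apply: (row_content_inj nN (SYT_lattice Pl HT) (SYT_lattice Pm HS)).
  apply: agree_trans (agree_sym (content_word_lattice Pl HT N)) _.
  exact: agree_trans A (content_word_lattice Pm HS N).
have le U W nu ka : is_partition n nu -> is_partition n ka -> is_SYT nu U ->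
    is_SYT ka W -> (forall j, 0 < j <= n -> row_of U j = row_of W j) -> size U <= size W.
  move=> Pn Pk HU HW Rj; rewrite leqNgt; apply/negP => lt.
  have /hasP[j] := SYT_row_nonempty Pn HU lt; rewrite mem_iota => Hj.
  rewrite Rj; last lia.
  by have := SYT_row_lt Pk HW (j := j); lia.
have Es : size T = size S.
  apply/eqP; rewrite eqn_leq (le T S lam mu) // (le S T mu lam) //.
  by move=> j Hj; rewrite R.
rewrite (SYT_tableau_of Pl HT) (SYT_tableau_of Pm HS) Es.
apply: eq_map => y; apply: eq_in_filter => j; rewrite mem_iota => Hj.
by rewrite R //; lia.
Qed.

Lemma ex_SYT N n f : n <= N -> valid N f n ->
  exists lam T, [/\ is_partition n lam, is_SYT lam T & agree n (content_word N T) f].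
Proof.
move=> nN V; have [r Lr Ar] := ex_lattice nN V.
(* [h] is the number of nonempty rows; the search succeeds because row n is empty after n
   entries. *)
pose L := row_length r n; pose h := find (fun y => L y == 0) (iota 0 n.+1).
have hn : h <= n.
  have : has (fun y => L y == 0) (iota 0 n.+1).
    by apply/hasP; exists n; [rewrite mem_iota; lia | rewrite /L (row_length_0 Lr)].
  by rewrite has_find size_iota.
have Lh : L h = 0.
  have /(nth_find 0)/eqP : has (fun y => L y == 0) (iota 0 n.+1).
    by apply/hasP; exists n; [rewrite mem_iota; lia | rewrite /L (row_length_0 Lr)].
  by rewrite -/h nth_iota //; lia.
have Lpos y : (0 < L y) = (y < h).
  have [yh|hy] := ltnP y h.
    by have := before_find 0 yh; rewrite nth_iota ?add0n; lia.
  by have := lattice_antitone Lr (leqnn n) hy; rewrite -/L -/(L h) -/(L y); lia.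
have rh j : 0 < j <= n -> r j < h.
  move=> Hj; rewrite -Lpos /L /row_length -has_count; apply/hasP; exists j => //.
  by rewrite mem_iota; lia.
pose lam := [seq L y | y <- iota 0 h]; pose T := tableau_of r n h.
have sizeT : map size T = lam.
  by rewrite /T /tableau_of -map_comp; apply: eq_map => y /=; rewrite size_filter.
have nthlam y : nth 0 lam y = L y.
  have [yh|hy] := ltnP y h; first by rewrite (nth_map 0) ?size_iota // nth_iota.
  rewrite nth_default ?size_map ?size_iota //; apply/esym/eqP.
  by rewrite -leqn0 leqNgt Lpos -leqNgt.
have permT : perm_eq (flatten T) (iota 1 n).
  apply: uniq_perm; first 1 last.
  - exact: iota_uniq.
  - move=> j; apply/flattenP/idP => [[s /mapP[y _ ->]]|Hj]; first by rewrite mem_filter => /andP[].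
    exists [seq i <- iota 1 n | r i == r j]; last by rewrite mem_filter eqxx.
    by apply/mapP; exists (r j) => //; rewrite mem_iota rh //; move: Hj; rewrite mem_iota; lia.
  have U ys : uniq ys -> uniq (flatten [seq [seq j <- iota 1 n | r j == y] | y <- ys]).
    elim: ys => //= y ys IH /andP[ny uys].
    rewrite cat_uniq IH // filter_uniq ?iota_uniq // andbT /=.
    apply/hasPn => j /flattenP[s /mapP[z zs ->]]; rewrite !mem_filter => /andP[/eqP rj _].
    by rewrite rj negb_and; apply/orP; left; apply: contra ny => /eqP <-.
  by apply: U; apply: iota_uniq.
have Pl : is_partition n lam.
  apply/and3P; split.
  - by apply/(sortedP 0) => y _; rewrite !nthlam; apply: (lattice_antitone Lr).
  - by apply/allP => x /mapP[y]; rewrite mem_iota => Hy ->; rewrite Lpos; lia.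
  - by rewrite -sizeT -size_flatten (perm_size permT) size_iota.
have HT : is_SYT lam T.
  split=> //.
  - by case/and3P: Pl => _ _ /eqP ->.
  - apply/allP => s /mapP[y _ ->].
    by apply: sorted_filter; [exact: ltn_trans | exact: iota_ltn_sorted].
  move=> y x; rewrite nthlam => Hx.
  have yh : y.+1 < h by rewrite -Lpos; lia.
  rewrite /T !nth_tableau_of //; last lia.
  set s := [seq j <- iota 1 n | r j == y.+1]; set t := nth 0 s x.
  have xs : x < size s by rewrite size_filter.
  have := mem_nth 0 xs; rewrite -/t mem_filter mem_iota => /andP[/eqP rt Ht].
  have Ht' : 0 < t <= n by lia.
  have xE : row_length r t.-1 y.+1 = x.
    have := index_fiber r Ht'; rewrite rt -/s => <-.
    by rewrite index_uniq // filter_uniq // iota_uniq.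
  apply: nth_fiber_lt; first lia.
  by rewrite -xE; apply: Lr; rewrite ?prednK //; lia.
exists lam, T; split=> //.
apply: agree_trans Ar; apply/agreeP => j Hj.
have rowE : row_of T j = r j.
  apply: (SYT_row_of Pl HT); rewrite /T nth_tableau_of ?rh // mem_filter eqxx mem_iota.
  by lia.
by rewrite /content_word /col_of rowE /T nth_tableau_of ?rh // index_fiber.
Qed.

(** * The reading word, and d_i on tableaux *)

Lemma cell_le_trans : transitive cell_le.
Proof. by move=> [b1 b2] [a1 a2] [c1 c2]; rewrite /cell_le /=; lia. Qed.

Lemma cell_le_total : total cell_le.
Proof. by move=> [a1 a2] [b1 b2]; rewrite /cell_le /=; lia. Qed.

Lemma index_map_in (A B : eqType) (f : A -> B) (s : seq A) x :
  {in s &, injective f} -> x \in s -> index (f x) (map f s) = index x s.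
Proof.
elim: s => //= y s IH inj xs; have [->|ne] := eqVneq y x; first by rewrite eqxx.
have [E|_] := eqVneq (f y) (f x).
  by move: ne; rewrite (inj y x) ?eqxx // mem_head.
rewrite IH //; last by move: xs; rewrite inE eq_sym (negbTE ne).
by move=> u v us vs; apply: inj; rewrite inE ?us ?vs orbT.
Qed.

Section ReadingWord.

Variables (n : nat) (lam : seq nat) (T : seq (seq nat)).
Hypotheses (Plam : is_partition n lam) (ST : is_SYT lam T).

Let cell j := (col_of T j, row_of T j).

Lemma mem_cells c : (c \in cells_of T) = (c.1 < size (nth [::] T c.2)).
Proof.
case: c => x y; apply/flattenP/idP => [[s /mapP[z _ ->]]|/= H].
  by case/mapP=> w; rewrite mem_iota => Hw [-> ->]; move: Hw => /=; lia.
exists [seq (w, y) | w <- iota 0 (size (nth [::] T y))].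
  apply/mapP; exists y => //; rewrite mem_iota /= add0n ltnNge.
  by apply/negP => le; rewrite nth_default in H.
by apply/mapP; exists x => //; rewrite mem_iota.
Qed.

Lemma cell_entry c : c \in cells_of T -> cell (entry T c) = c.
Proof.
case: c => x y; rewrite mem_cells /entry /= => H.
have M : nth 0 (nth [::] T y) x \in nth [::] T y by apply: mem_nth.
have R := SYT_row_of Plam ST M; rewrite /cell /col_of R index_uniq //.
by rewrite (SYT_row Plam ST) filter_uniq // iota_uniq.
Qed.

Lemma entry_cell j : 0 < j <= n -> cell j \in cells_of T /\ entry T (cell j) = j.
Proof.
move=> Hj; have M : j \in nth [::] T (row_of T j) by rewrite (SYT_mem_row Plam ST) Hj eqxx.
by rewrite mem_cells /entry /= index_mem nth_index.
Qed.

Lemma reading_word_lt i j : 0 < i <= n -> 0 < j <= n ->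
  content_word n T i < content_word n T j ->
  index i (reading_word T) < index j (reading_word T).
Proof.
move=> Hi Hj lt; set s := sort cell_le (cells_of T).
have inj : {in s &, injective (entry T)}.
  move=> c d; rewrite !mem_sort => Hc Hd E.
  by rewrite -(cell_entry Hc) -(cell_entry Hd) E.
have mem k : 0 < k <= n -> cell k \in s.
  by move=> Hk; have [M _] := entry_cell Hk; rewrite mem_sort.
have idx k : 0 < k <= n -> index k (reading_word T) = index (cell k) s.
  move=> Hk; have [_ Ek] := entry_cell Hk.
  by rewrite /reading_word -/s -{1}Ek (index_map_in inj) ?mem.
rewrite !idx // ltnNge; apply/negP.
have refl : reflexive cell_le by move=> c; rewrite /cell_le; lia.
move/(sorted_leq_index cell_le_trans refl (sort_sorted cell_le_total _)).
move/(_ (mem j Hj) (mem i Hi)); move: lt; rewrite /content_word /cell_le /=.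
have row_le k : 0 < k <= n -> row_of T k <= n.
  move=> Hk; have := SYT_row_lt Plam ST Hk.
  by rewrite (SYT_size ST); have := partition_size Plam; lia.
by have := row_le i Hi; have := row_le j Hj; lia.
Qed.

Let V : valid n (content_word n T) n := SYT_valid Plam ST (leqnn n).

Lemma reading_word_ltE i j : 0 < i <= n -> 0 < j <= n ->
  content_word n T i != content_word n T j ->
  (index i (reading_word T) < index j (reading_word T)) =
  (content_word n T i < content_word n T j).
Proof.
move=> Hi Hj; rewrite neq_ltn => /orP[lt|gt].
  by rewrite lt reading_word_lt.
by have := reading_word_lt Hj Hi gt; lia.
Qed.

Lemma desc_sigE j : 0 < j < n -> desc_sig T j = ascent (content_word n T) j.
Proof.
by move=> Hj; rewrite /desc_sig reading_word_ltE //; [lia | lia | apply: (valid_neq1 V)].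
Qed.

Definition relabel (h : nat) : seq (seq nat) := map (map (swapv h h.+1)) T.

Lemma swapvK h : involutive (swapv h h.+1).
Proof.
move=> x; rewrite /swapv; have [->|n1] := eqVneq x h.
  by rewrite eqxx; have -> : (h.+1 == h) = false by lia.
have [->|n2] := eqVneq x h.+1; first by rewrite eqxx.
by rewrite (negbTE n1) (negbTE n2).
Qed.

Lemma mem_map_swapv h j s : (j \in map (swapv h h.+1) s) = (swapv h h.+1 j \in s).
Proof. by rewrite -{1}(swapvK h j) mem_map //; apply: inv_inj (swapvK h). Qed.

Lemma row_of_relabel h j : row_of (relabel h) j = row_of T (swapv h h.+1 j).
Proof.
by rewrite /row_of /relabel find_map; apply: eq_find => s /=; rewrite mem_map_swapv.
Qed.

Lemma nth_relabel h y : nth [::] (relabel h) y = map (swapv h h.+1) (nth [::] T y).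
Proof.
have [lt|ge] := ltnP y (size T); first by rewrite (nth_map [::]).
by rewrite !nth_default ?size_map.
Qed.

Lemma content_word_relabel N h :
  content_word N (relabel h) =1 transpose h (content_word N T).
Proof.
move=> j; have -> : transpose h (content_word N T) j = content_word N T (swapv h h.+1 j).
  by rewrite /transpose /swapv; case: ifP => // _; case: ifP.
rewrite /content_word row_of_relabel; congr (_ + _ - _).
rewrite /col_of row_of_relabel nth_relabel -{1}(swapvK h j) index_map //.
exact: inv_inj (swapvK h).
Qed.

Lemma swapv_lt h u v : u < v -> ~~ ((u == h) && (v == h.+1)) ->
  swapv h h.+1 u < swapv h h.+1 v.
Proof. by rewrite /swapv; repeat case: ifP => ?; lia. Qed.

Lemma content_word_entry x y : x < size (nth [::] T y) ->
  [/\ 0 < nth 0 (nth [::] T y) x <= n, y <= n &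
      content_word n T (nth 0 (nth [::] T y) x) = n + x - y].
Proof.
move=> H; have M : nth 0 (nth [::] T y) x \in nth [::] T y by apply: mem_nth.
have R := SYT_row_of Plam ST M; split.
- by move: M; rewrite (SYT_mem_row Plam ST) => /andP[].
- have yT : y < size T by rewrite ltnNge; apply/negP => le; rewrite nth_default in H.
  by have := partition_size Plam; rewrite -(SYT_size ST); lia.
rewrite /content_word /col_of R index_uniq //.
by rewrite (SYT_row Plam ST) filter_uniq // iota_uniq.
Qed.

(** Exchanging h and h+1 can break standardness only if they are adjacent in a row or column, and
    then their contents differ by one. *)
Lemma relabel_SYT h : 0 < h < n ->
  far (content_word n T h) (content_word n T h.+1) -> is_SYT lam (relabel h).
Proof.
move=> Hh F; have [S1 S2 S3 S4] := ST.
split.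
- by rewrite -S1 /relabel -map_comp; apply: eq_map => s /=; rewrite size_map.
- rewrite /relabel -map_flatten; case/and3P: Plam => _ _ /eqP ->.
  apply: uniq_perm; first 1 last.
  + exact: iota_uniq.
  + move=> j; rewrite mem_map_swapv (SYT_mem Plam ST) mem_iota /swapv.
    by case: ifP => ?; [|case: ifP => ?]; lia.
  rewrite map_inj_uniq ?(perm_uniq (SYT_perm Plam ST)) ?iota_uniq //.
  exact: inv_inj (swapvK h).
- apply/allP => s /(nthP [::])[y yT <-]; rewrite size_map in yT.
  rewrite nth_relabel; apply/(sortedP 0) => x; rewrite size_map => Hx.
  rewrite !(nth_map 0) //; last exact: ltnW.
  apply: swapv_lt.
    by have /allP/(_ _ (mem_nth [::] yT))/(sortedP 0) := S3; apply.
  apply/negP => /andP[/eqP E1 /eqP E2].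
  have [_ yn C1] := content_word_entry (ltnW Hx).
  have [_ _ C2] := content_word_entry Hx.
  by rewrite E1 in C1; rewrite E2 in C2; move: F; rewrite /far C1 C2; lia.
move=> y x Hx; have Hx1 := Hx; rewrite -(SYT_row_size ST) in Hx1.
have Hx2 : x < size (nth [::] T y).
  by rewrite (SYT_row_size ST); apply: leq_trans Hx (partition_antitone y Plam).
rewrite !nth_relabel !(nth_map 0) //; apply: swapv_lt; first exact: S4.
apply/negP => /andP[/eqP E1 /eqP E2].
have [_ _ C1] := content_word_entry Hx2.
have [_ yn C2] := content_word_entry Hx1.
by rewrite E1 in C1; rewrite E2 in C2; move: F; rewrite /far C1 C2; lia.
Qed.

(** Positions in the reading word and contents order the entries i-1, i, i+1 alike, so the choices
    made by [dual_op] and [dual_word] coincide. *)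
Lemma dual_opE i : 1 < i < n ->
  is_SYT lam (dual_op i T) /\
  agree n (content_word n (dual_op i T)) (dual_word i (content_word n T)).
Proof.
move=> Hi; set f := content_word n T.
have N1 : f i.-1 != f i.
  by have := valid_neq1 V (i := i.-1); rewrite prednK; [apply; lia | lia].
have N2 : f i != f i.+1 by apply: (valid_neq1 V); lia.
have N3 : f i.-1 != f i.+1 by apply: (valid_neq2 V).
have := @reading_word_ltE i.-1 i ltac:(lia) ltac:(lia) N1.
have := @reading_word_ltE i i.+1 ltac:(lia) ltac:(lia) N2.
have := @reading_word_ltE i.-1 i.+1 ltac:(lia) ltac:(lia) N3.
have := @reading_word_ltE i i.-1 ltac:(lia) ltac:(lia) ltac:(by rewrite eq_sym).
have := @reading_word_ltE i.+1 i ltac:(lia) ltac:(lia) ltac:(by rewrite eq_sym).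
have := @reading_word_ltE i.+1 i.-1 ltac:(lia) ltac:(lia) ltac:(by rewrite eq_sym).
rewrite -/f /dual_op.
set p := index i.-1 _; set q := index i _; set r := index i.+1 _.
move=> H1 H2 H3 H4 H5 H6.
have relabelP h : 0 < h < n -> far (f h) (f h.+1) -> dual_word i f = transpose h f ->
    is_SYT lam (relabel h) /\
    agree n (content_word n (relabel h)) (dual_word i f).
  move=> Hh F ->; split; first exact: relabel_SYT.
  by apply/agreeP => j _; apply: content_word_relabel.
have [[B D]|[B D]|[B D]] := dual_wordP V Hi; rewrite -/f in B D *.
- rewrite ifT; first by rewrite D; split=> //; exact: agree_refl.
  by move: B; rewrite /between; lia.
- rewrite ifF; last by apply/negbTE; move: B; rewrite /between; lia.
  rewrite ifT; last by move: B; rewrite /between /ndist; lia.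
  have -> : map (map (swapv i i.-1)) T = relabel i.-1.
    apply: eq_map => s; apply: eq_map => x; rewrite /swapv prednK; last lia.
    by have [->|n1] := eqVneq x i; [rewrite ifF //; lia | ].
  by apply: relabelP => //; rewrite ?prednK //; move: B; rewrite /between /far; lia.
- rewrite ifF; last by apply/negbTE; move: B; rewrite /between; lia.
  rewrite ifF; last by apply/negbTE; move: B; rewrite /between /ndist; lia.
  by apply: relabelP => //; move: B; rewrite /between /far; lia.
Qed.

End ReadingWord.

Lemma dual_ops_SYT n lam T s : is_partition n lam -> is_SYT lam T -> colors n s ->
  is_SYT lam (foldr dual_op T s) /\
  agree n (content_word n (foldr dual_op T s)) (dual_words s (content_word n T)).
Proof.
move=> Pl ST; elim: s => [_|i s IH /andP[Hi /IH[Ss As]]]; first by split=> //; exact: agree_refl.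
have [S1 A1] := dual_opE Pl Ss Hi; split=> //.
by apply: agree_trans A1 _; apply: agree_dual.
Qed.

Lemma G_edgeE n lam T S i : is_partition n lam -> is_SYT lam T -> is_SYT lam S ->
  1 < i < n -> G_edge i T S = (S == dual_op i T) && (T != S).
Proof.
move=> Pl HT HS Hi; rewrite /G_edge; apply/orb_idr => /andP[/eqP E ne].
rewrite ne andbT; apply/eqP.
have [S1 A1] := dual_opE Pl HS Hi; rewrite -E in A1.
have [S2 A2] := dual_opE Pl HT Hi.
apply: (content_word_inj (leqnn n) Pl Pl HS S2).
apply: agree_trans (agree_sym A2); apply: agree_sym.
apply: agree_trans (agree_dual Hi A1) _.
exact: (dual_wordK (SYT_valid Pl HS (leqnn n)) Hi).
Qed.

(** * The isomorphism with a standard graph, and uniqueness of the partition *)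

Section Isomorphism.

Variables (n : nat) (V : finType) (sigma : V -> nat -> bool) (E : nat -> rel V).
Hypothesis graphE : signed_colored_graph n E.
Hypothesis degE : dual_equivalence_graph n n sigma E.

Let ax1 : deg_ax1 n sigma E. Proof. by case: degE. Qed.

Lemma mem_component v x : x \in component E (iota 2 (n - 2)) v <->
  exists2 s, colors n s & x = acts E s v.
Proof. by rewrite inE; apply: (connectP_acts ax1 v x (leqnn n)). Qed.

Lemma ex_iso v : exists lam, is_partition n lam /\
  iso_to_G n sigma E (component E (iota 2 (n - 2)) v) lam.
Proof.
have [_ _ ax2 ax3 [ax4 [ax5 ax6]]] := degE.
have [phi C] := ex_coding graphE ax1 ax2 ax3 ax4 ax5 ax6 (leqnn n).
have nn := leqnn n.
have [lam [T0 [Pl S0 A0]]] := ex_SYT nn (coding_valid C v).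
exists lam; split=> //; set D := component _ _ _.
(* [f T] is the vertex of the component coded by the word of [T]: it exists because words of one
   shape are connected, and is unique by [coding_eq]. *)
pose f T := odflt v [pick x in D | agree n (phi x) (content_word n T)].
have reach T : is_SYT lam T -> exists2 s, colors n s &
    agree n (phi (acts E s v)) (content_word n T).
  move=> ST.
  have [||k|s Cs As] := @dual_words_connected n (phi v) (content_word n T) n.
  - exact: (coding_valid C v).
  - exact: (SYT_valid Pl ST nn).
  - by rewrite -(eq_state n A0) (SYT_state Pl S0 nn) (SYT_state Pl ST nn).
  by exists s => //; apply: agree_trans (coding_acts nn nn C v Cs) As.
have fP T : is_SYT lam T -> f T \in D /\ agree n (phi (f T)) (content_word n T).
  move=> ST; rewrite /f; case: pickP => [x /andP[]//|no].
  have [s Cs As] := reach T ST; move: (no (acts E s v)); rewrite As andbT => /negP[].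
  by apply/mem_component; exists s.
have injD x y : x \in D -> y \in D -> agree n (phi x) (phi y) -> x = y.
  move=> /mem_component[s Cs ->] /mem_component[t Ct ->].
  exact: (coding_eq graphE ax1 nn nn C).
have fE T x : is_SYT lam T -> x \in D -> agree n (phi x) (content_word n T) -> f T = x.
  move=> ST xD Ax; have [fD Af] := fP T ST; apply: injD => //.
  exact: agree_trans Af (agree_sym Ax).
have f_inj T S : is_SYT lam T -> is_SYT lam S -> f T = f S -> T = S.
  move=> ST SS Ef; have [_ AT] := fP T ST; have [_ AS] := fP S SS.
  apply: (content_word_inj nn Pl Pl ST SS).
  by apply: agree_trans (agree_sym AT) _; rewrite Ef.
have f_dual T i : is_SYT lam T -> 1 < i < n -> f (dual_op i T) = neighbor E i (f T).
  move=> ST Hi; have [fD Af] := fP T ST; have [S1 A1] := dual_opE Pl ST Hi.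
  apply: fE => //.
    have /mem_component[s Cs ->] := fD; apply/mem_component; exists (i :: s) => //.
    by rewrite colors_cons Hi.
  apply: agree_trans (coding_neighbor C _ Hi) _.
  by apply: agree_trans (agree_sym A1); apply: agree_dual.
exists f; split=> //.
- by move=> T /fP[].
- move=> x xD; have /mem_component[s Cs Ex] := xD.
  have [Ss As] := dual_ops_SYT Pl S0 Cs.
  exists (foldr dual_op T0 s) => //; apply: fE => //; rewrite Ex.
  apply: agree_trans (coding_acts nn nn C v Cs) _; apply: agree_trans (agree_sym As).
  by apply: agree_duals => //; apply: agree_sym.
- move=> T j ST Hj; have [_ Af] := fP T ST.
  rewrite (coding_sigma C) // (desc_sigE Pl ST) // /ascent.
  by rewrite !(agreeP _ _ _ Af) //; lia.
move=> T S i ST SS Hi; rewrite (G_edgeE Pl ST SS Hi).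
have [S1 _] := dual_opE Pl ST Hi.
apply/idP/andP => [e|[/eqP -> ne]].
  have En := neighborE ax1 Hi e; rewrite -f_dual // in En.
  split; first by rewrite (f_inj _ _ S1 SS En).
  apply: contraTneq e => ->.
  by have [_ irr] := graphE Hi; rewrite irr.
rewrite f_dual //; have [//|[fix_ _]] := edge_or_fixed ax1 (f T) Hi.
by case/negP: ne; apply/eqP/f_inj; rewrite ?f_dual.
Qed.

(** Let T and S be the tableaux sent to [v] by the two isomorphisms. Any sequence of colours carries
    them to tableaux with equal signatures, namely that of the corresponding vertex, so [rigid]
    identifies their words, and hence T, S and their shapes. *)
Lemma iso_unique v lam mu : is_partition n lam -> is_partition n mu ->
  iso_to_G n sigma E (component E (iota 2 (n - 2)) v) lam ->
  iso_to_G n sigma E (component E (iota 2 (n - 2)) v) mu -> lam = mu.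
Proof.
move=> Pl Pm; have nn := leqnn n.
have step ka f : is_partition n ka ->
    (forall T, is_SYT ka T -> f T \in component E (iota 2 (n - 2)) v) ->
    (forall x, x \in component E (iota 2 (n - 2)) v -> exists2 T, is_SYT ka T & f T = x) ->
    (forall T T' i, is_SYT ka T -> is_SYT ka T' -> 1 < i < n -> E i (f T) (f T') = G_edge i T T') ->
    forall T s, is_SYT ka T -> colors n s -> f (foldr dual_op T s) = acts E s (f T).
  move=> Pk fD fS fE T s ST; elim: s => //= i s IH /andP[Hi Cs]; rewrite -IH //.
  have [SU _] := dual_ops_SYT Pk ST Cs; set U := foldr _ _ _ in SU *.
  have [SW _] := dual_opE Pk SU Hi.
  have [eq|ne] := eqVneq U (dual_op i U); last first.
    by apply/esym/(neighborE ax1 Hi); rewrite fE // (G_edgeE Pk) // eqxx.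
  have [e|[-> _]] := edge_or_fixed ax1 (f U) Hi; last by rewrite -eq.
  (* Here d_i fixes [U], so no edge can leave [f U]: its other end would be the image of d_i applied
     to [U], which is [U], whereas edges join distinct tableaux. *)
  have [W SW' EW] : exists2 W, is_SYT ka W & f W = neighbor E i (f U).
    apply: fS; have /mem_component[t Ct ->] := fD _ SU.
    by apply/mem_component; exists (i :: t) => //; rewrite colors_cons Hi.
  by move: e; rewrite -EW fE // (G_edgeE Pk) // -eq => /andP[/eqP ->]; rewrite eqxx.
move=> [f [fD _ fS fsig fE]] [g [gD _ gS gsig gE]].
have vD : v \in component E (iota 2 (n - 2)) v by rewrite inE connect0.
have [T ST Tv] := fS v vD; have [S SS Sv] := gS v vD.
have sigE ka h U s j : is_partition n ka -> is_SYT ka U -> colors n s -> 0 < j < n ->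
    (forall T j, is_SYT ka T -> 0 < j < n -> sigma (h T) j = desc_sig T j) ->
    h (foldr dual_op U s) = acts E s (h U) ->
    ascent (dual_words s (content_word n U)) j = sigma (acts E s (h U)) j.
  move=> Pk SU Cs Hj Hs Hh; have [S1 A1] := dual_ops_SYT Pk SU Cs.
  rewrite -Hh Hs // (desc_sigE Pk S1) // /ascent.
  by rewrite !(agreeP _ _ _ A1) //; lia.
suff TS : T = S by have [<- _ _ _] := ST; have [<- _ _ _] := SS; rewrite TS.
apply: (content_word_inj nn Pl Pm ST SS).
apply: (rigid (SYT_valid Pl ST nn) (SYT_valid Pm SS nn)) => s j Cs Hj.
rewrite (sigE lam f) // ?(step lam f) // (sigE mu g) // ?(step mu g) //.
by rewrite Tv Sv.
Qed.

End Isomorphism.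

Theorem theorem3p5 (n : nat) (V : finType) (sigma : V -> nat -> bool)
  (E : nat -> rel V) :
  signed_colored_graph n E ->
  dual_equivalence_graph n n sigma E ->
  forall v : V,
    exists! lam : seq nat,
      is_partition n lam /\ iso_to_G n sigma E (component E (seq.iota 2 (n - 2)) v) lam.
Proof.
move=> graphE degE v; have [lam [Pl Il]] := ex_iso graphE degE v.
exists lam; split=> // mu [Pm Im].
exact: (iso_unique degE Pl Pm Il Im).
Qed.
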